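(* Let $e\ge 10$ and let $1\le m<n\le e-2$ be integers with $(m,n)\ne(e-4,e-3)$. Then the set $\mathcal G_{S(e,m,n)}=G_{S(e,m,n)}\cup G'_{S(e,m,n)}$ (defined explicitly in the context) is a Gröbner basis of $I_{S(e,m,n)}$ with respect to the graded reverse lexicographic order on $R(e,m,n)$.
   Context: $\mathbb K$ is an algebraically closed field of characteristic zero. $S(e,m,n)$ is the numerical semigroup generated by $\{e,e+1,\ldots,2e-1\}\setminus\{e+m,e+n\}$; $R(e,m,n)=\mathbb K[\{x_0,\ldots,x_{e-1}\}\setminus\{x_m,x_n\}]$; $I_{S(e,m,n)}$ is the kernel of $R(e,m,n)\to\mathbb K[t]$, $x_i\mapsto t^{e+i}$. The graded reverse lexicographic order is taken with $x_0>x_1>\cdots>x_{e-1}$ (so $x_{e-1}$ is the least variable). Write $[a,b]$ for the set of integers $i$ with $a\le i\le b$ (empty if $a>b$); index ranges with lower bound exceeding upper bound are empty. **The set $G_{S(e,m,n)}$ for $m=1$.** $G_{S(e,1,n)}=J_n\cup K_n\cup L_{e,n}$, where $J_n$ is the set of all $2\times2$ minors of $A_n$ and $K_n$ the set of $2\times 2$ minors of $B_n$ involving its first column. $A_n$ has columns $\begin{bmatrix} x_i \\ x_{i+1} \end{bmatrix}$ for $i\in[2,n-2]$, then for $i\in[n+1,e-2]$, then $\begin{bmatrix} x_{e-1} \\ x_0^2 \end{bmatrix}$. $B_2$ has columns $\begin{bmatrix} x_0 \\ x_3 \end{bmatrix}$, $\begin{bmatrix} x_i \\ x_{i+3} \end{bmatrix}$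 for $i\in[3,e-4]$, $\begin{bmatrix} x_{e-3} \\ x_0^2 \end{bmatrix}$. For $n\ge3$, $B_n$ has columns $\begin{bmatrix} x_0 \\ x_2 \end{bmatrix}$, $\begin{bmatrix} x_i \\ x_{i+2} \end{bmatrix}$ for $i\in[2,n-3]$, $\begin{bmatrix} x_{n-1} \\ x_{n+1} \end{bmatrix}$, $\begin{bmatrix} x_i \\ x_{i+2} \end{bmatrix}$ for $i\in[n+1,e-3]$, and, if $n\ne e-2$, $\begin{bmatrix} x_{e-2} \\ x_0^2 \end{bmatrix}$. Further: - $L_{e,2}=\emptyset$. - $L_{e,3}=\{x_4x_{4+i}-x_2x_{6+i}\mid i\in[0,e-7]\}\cup\{x_0^2x_2-x_4x_{e-2}\}$. - $L_{e,4}=\{x_5x_{5+i}-x_3x_{7+i}\mid i\in[0,e-8]\}\cup\{x_3^2-x_0x_6,\ x_0^2x_3-x_5x_{e-2},\ x_0x_2^2-x_5x_{e-1},\ x_2^3-x_7x_{e-1}\}$. - For $5\le n\le e-4$: $L_{e,n}=\{x_{n+1}x_{n+1+i}-x_{n-1}x_{n+3+i}\mid i\in[0,e-n-4]\}\cup\{x_{n-1}x_{n-1-i}-x_{n+1}x_{n-3-i}\mid i\in[0,n-5]\}\cup\{x_{n-1}x_3-x_{n+2}x_0,\ x_0^2x_{n-1}-x_{n+1}x_{e-2},\ x_0x_2x_{n-2}-x_{n+1}x_{e-1}\}$. - $L_{e,e-3}=\{x_{e-4}x_{e-4-i}-x_{e-2}x_{e-6-i}\mid i\in[0,e-8]\}\cup\{x_{e-4}x_3-x_0x_{e-1},\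 x_0^2x_{e-4}-x_{e-2}^2,\ x_0x_2x_{e-5}-x_{e-2}x_{e-1}\}$. - $L_{e,e-2}=\{x_{e-3}x_{e-3-i}-x_{e-1}x_{e-5-i}\mid i\in[0,e-7]\}\cup\{x_0^3-x_3x_{e-3},\ x_0x_2x_{e-4}-x_{e-1}^2\}$. **The set $G_{S(e,m,n)}$ for $m\ge2$.** $G_{S(e,m,n)}=J_{m,n}\cup K_{m,n}$, where $J_{m,n}$ is the set of all $2\times2$ minors of the matrix $A_{m,n}$ with columns $\begin{bmatrix} x_i \\ x_{i+1} \end{bmatrix}$ for $i\in[0,m-2]$, then for $i\in[m+1,n-2]$, then for $i\in[n+1,e-2]$, then $\begin{bmatrix} x_{e-1} \\ x_0^2 \end{bmatrix}$; and $K_{m,n}$ is as follows (in each item $m,n$ are the indices of $K_{m,n}$): 1. $K_{2,3}=\{x_{n+1}x_{n+1+j}-x_{n-2}x_{n+4+j}\mid j\in[0,e-n-5]\}\cup\{x_0^2x_{m-1}-x_{m+3}x_{e-4},\ x_0x_1x_{m-1}-x_{m+3}x_{e-3},\ x_1^3-x_4x_{e-1}\}$. 2. $K_{2,4}=\{x_{m+1}x_{m+1+j}-x_{m-1}x_{m+3+j}\mid j\in[0,e-m-4]\setminus\{1\}\}\cup\{x_{n+1}x_{n+1+j}-x_{n-1}x_{n+3+j}\mid j\in[0,e-n-4]\}\cup\{x_0^2x_{m-1}-x_{m+1}x_{e-2},\ x_0x_1x_{m-1}-x_{m+1}x_{e-1},\ x_0x_1x_{n-1}-x_{n+2}x_{e-2},\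 x_0^2x_{n-1}-x_{n+2}x_{e-3},\ x_1^3-x_6x_{e-3},\ x_1^2x_{n-1}-x_{n+2}x_{e-1}\}$. 3. $K_{2,5}=\{x_{m+1}^2-x_{m-2}x_{m+4}\}\cup\{x_{m+1}x_{m+1+j}-x_{m-1}x_{m+3+j}\mid j\in[1,e-m-4]\setminus\{2\}\}\cup\{x_{n+1}x_{n+1+j}-x_{n-1}x_{n+3+j}\mid j\in[0,e-n-4]\}\cup\{x_{n-1}^2-x_{n+2}x_{n-4}\}\cup\{x_0x_1x_{n-1}-x_{n+2}x_{e-2},\ x_0^2x_{n-1}-x_{n+2}x_{e-3},\ x_1^2x_{n-1}-x_{n+2}x_{e-1},\ x_0^2x_{m-1}-x_{m+2}x_{e-3},\ x_0x_1x_{m-1}-x_{m+2}x_{e-2},\ x_1^3-x_4x_{e-1}\}$. 4. For $6\le n\le e-4$: $K_{2,n}=\{x_{m+1}x_{n-2}-x_0x_{n+1}\}\cup\{x_{m+1}x_{m+1+j}-x_{m-1}x_{m+3+j}\mid j\in[0,e-m-4]\setminus\{n-m-1,n-m-3\}\}\cup\{x_{n+1}x_{n+1+j}-x_{n-1}x_{n+3+j}\mid j\in[0,e-n-4]\}\cup\{x_{n-1}x_{n-1-j}-x_{n+1}x_{n-3-j}\mid j\in[0,n-m-4]\}\cup\{x_{n-1}x_{m+2}-x_{n+2}x_{m-1}\}\cup\{x_0x_1x_{n-1}-x_{n+2}x_{e-2},\ x_0^2x_{n-1}-x_{n+2}x_{e-3},\ x_0^2x_{m-1}-x_{m+2}x_{e-3},\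 x_0x_1x_{m-1}-x_{m+2}x_{e-2},\ x_1^3-x_4x_{e-1}\}$. 5. $K_{2,e-3}=\{x_{m+1}x_{n-2}-x_0x_{n+1}\}\cup\{x_{m+1}x_{m+1+j}-x_{m-1}x_{m+3+j}\mid j\in[0,e-m-5]\setminus\{n-m-3\}\}\cup\{x_{n-1}x_{n-1-j}-x_{n+1}x_{n-3-j}\mid j\in[0,n-m-4]\}\cup\{x_{n-1}x_{m+2}-x_{n+2}x_{m-1}\}\cup\{x_0x_1x_{n-1}-x_{n+1}x_{e-1},\ x_0^2x_{n-1}-x_{n+1}x_{e-2},\ x_0^2x_{m-1}-x_{m+3}x_{e-4},\ x_0x_1x_{m-1}-x_{m+2}x_{e-2},\ x_1^3-x_4x_{e-1}\}$. 6. $K_{2,e-2}=\{x_{m+1}x_{n-2}-x_0x_{n+1}\}\cup\{x_{m+1}x_{m+1+j}-x_{m-1}x_{m+3+j}\mid j\in[0,e-m-4]\setminus\{n-m-3\}\}\cup\{x_{n-1}x_{n-1-j}-x_{n+1}x_{n-3-j}\mid j\in[0,n-m-4]\}\cup\{x_0x_1x_{n-1}-x_{n+1}x_{e-1},\ x_0^2x_{m-1}-x_{m+2}x_{e-3},\ x_0x_1x_{m-1}-x_{m+3}x_{e-3},\ x_1^3-x_4x_{e-1}\}$. 7. $K_{3,4}=\{x_{n+1}x_{n+1+j}-x_{n-2}x_{n+4+j}\mid j\in[0,e-n-5]\}\cup\{x_0^2x_{m-1}-x_{m+3}x_{e-4},\ x_0x_1x_{m-1}-x_{m+3}x_{e-3},\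 x_0x_2x_{n-2}-x_{n+2}x_{e-2},\ x_2^2x_1-x_6x_{e-1},\ x_2^3-x_7x_{e-1}\}$. 8. For $4\le m\le e-6$: $K_{m,m+1}=\{x_{n+1}x_{n+1+j}-x_{n-2}x_{n+4+j}\mid j\in[0,e-n-5]\}\cup\{x_{m-1}x_{m-1-j}-x_{m+2}x_{m-4-j}\mid j\in[0,m-4]\}\cup\{x_0^2x_{m-1}-x_{m+2}x_{e-3},\ x_0x_1x_{m-1}-x_{m+2}x_{e-2},\ x_0x_2x_{n-2}-x_{n+2}x_{e-2}\}$. 9. $K_{e-5,e-4}=\{x_{m-1}x_{m-1-j}-x_{m+2}x_{m-4-j}\mid j\in[0,m-4]\}\cup\{x_0^2x_{m-1}-x_{m+2}x_{e-3},\ x_0x_1x_{m-1}-x_{m+2}x_{e-2},\ x_0x_2x_{n-2}-x_{n+2}x_{e-2}\}$. 10. $K_{e-3,e-2}=\{x_{m-1}x_{m-1-j}-x_{m+2}x_{m-4-j}\mid j\in[0,m-4]\}\cup\{x_0x_2x_{n-2}-x_{n+1}x_{e-1}\}$. 11. For $3\le m\le e-6$: $K_{m,m+2}=\{x_{m+1}x_{m+1+j}-x_{m-1}x_{m+3+j}\mid j\in[0,e-m-4]\setminus\{1\}\}\cup\{x_{n+1}x_{n+1+j}-x_{n-1}x_{n+3+j}\mid j\in[0,e-n-4]\}\cup\{x_{n-1}x_{n-3-j}-x_{n+1}x_{n-5-j}\mid j\in[0,n-5]\}\cup\{x_{m-1}x_{m-1-j}-x_{m+1}x_{m-3-j}\mid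 j\in[0,m-3]\}\cup\{x_0^2x_{m-1}-x_{m+1}x_{e-2},\ x_0x_1x_{m-1}-x_{m+1}x_{e-1},\ x_0x_1x_{n-1}-x_{n+2}x_{e-2},\ x_0^2x_{n-1}-x_{n+2}x_{e-3}\}$. 12. $K_{e-5,e-3}=\{x_{m+1}^2-x_{m-1}x_{m+3}\}\cup\{x_{n-1}x_{n-3-j}-x_{n+1}x_{n-5-j}\mid j\in[0,n-5]\}\cup\{x_{m-1}x_{m-1-j}-x_{m+1}x_{m-3-j}\mid j\in[0,m-3]\}\cup\{x_0^2x_{m-1}-x_{m+1}x_{e-2},\ x_0x_1x_{m-1}-x_{m+1}x_{e-1},\ x_0x_1x_{n-1}-x_{n+2}x_{e-2},\ x_0^2x_{n-1}-x_{n+1}x_{e-2}\}$. 13. $K_{e-4,e-2}=\{x_{m+1}^2-x_{m-1}x_{m+3}\}\cup\{x_{n-1}x_{n-3-j}-x_{n+1}x_{n-5-j}\mid j\in[0,n-5]\}\cup\{x_{m-1}x_{m-1-j}-x_{m+1}x_{m-3-j}\mid j\in[0,m-3]\}\cup\{x_0x_1x_{m-1}-x_{m+1}x_{e-1},\ x_0x_1x_{n-1}-x_{n+1}x_{e-1}\}$. 14. For $m\ge3$, $m+2<n\le e-4$: $K_{m,n}=\{x_{m+1}x_{n-2}-x_{m-2}x_{n+1}\}\cup\{x_{m+1}x_{m+1+j}-x_{m-1}x_{m+3+j}\mid j\in[0,e-m-4]\setminus\{n-m-1,n-m-3\}\}\cup\{x_{n+1}x_{n+1+j}-x_{n-1}x_{n+3+j}\mid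 j\in[0,e-n-4]\}\cup\{x_{n-1}x_{n-1-j}-x_{n+1}x_{n-3-j}\mid j\in[0,n-3]\setminus\{n-m-1,n-m-2,n-m-3\}\}\cup\{x_{n-1}x_{m+2}-x_{n+2}x_{m-1}\}\cup\{x_{m-1}x_{m-1-j}-x_{m+1}x_{m-3-j}\mid j\in[0,m-3]\}\cup\{x_0^2x_{m-1}-x_{m+2}x_{e-3},\ x_0x_1x_{m-1}-x_{m+2}x_{e-2},\ x_0x_1x_{n-1}-x_{n+2}x_{e-2},\ x_0^2x_{n-1}-x_{n+2}x_{e-3}\}$. 15. For $m\ge3$, $m+2<n=e-3$: $K_{m,n}=\{x_{m+1}x_{n-2}-x_{m-2}x_{n+1}\}\cup\{x_{m+1}x_{m+1+j}-x_{m-1}x_{m+3+j}\mid j\in[0,e-m-4]\setminus\{n-m-1,n-m-3\}\}\cup\{x_{n-1}x_{n-1-j}-x_{n+1}x_{n-3-j}\mid j\in[0,n-3]\setminus\{n-m-1,n-m-2,n-m-3\}\}\cup\{x_{n-1}x_{m+2}-x_{n+2}x_{m-1}\}\cup\{x_{m-1}x_{m-1-j}-x_{m+1}x_{m-3-j}\mid j\in[0,m-3]\}\cup\{x_0^2x_{m-1}-x_{m+1}x_{e-2},\ x_0x_1x_{m-1}-x_{m+1}x_{e-1},\ x_0x_1x_{n-1}-x_{n+2}x_{e-2},\ x_0^2x_{n-1}-x_{n+1}x_{e-2}\}$. 16. For $m\ge3$, $m+2<n=e-2$: $K_{m,n}=\{x_{m+1}x_{n-2}-x_{m-2}x_{n+1}\}\cup\{x_{m+1}x_{m+1+j}-x_{m-1}x_{m+3+j}\mid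 j\in[0,e-m-4]\setminus\{n-m-3\}\}\cup\{x_{n-1}x_{n-1-j}-x_{n+1}x_{n-3-j}\mid j\in[0,n-3]\setminus\{n-m-1,n-m-2,n-m-3\}\}\cup\{x_{m-1}x_{m-1-j}-x_{m+1}x_{m-3-j}\mid j\in[0,m-3]\}\cup\{x_0^2x_{m-1}-x_{m+2}x_{e-3},\ x_0x_1x_{m-1}-x_{m+1}x_{e-1},\ x_0x_1x_{n-1}-x_{n+1}x_{e-1}\}$. **The set $G'_{S(e,m,n)}$.** - $m=1$: $\emptyset$ if $n\in\{2,3,e-2\}$; $\{x_0x_5x_{e-2}-x_2^2x_{e-1},\ x_2^2x_{e-2}-x_0x_3x_{e-1}\}$ if $n=4$; $\{x_0x_{n+1}x_{e-2}-x_2x_{n-2}x_{e-1}\}$ if $n\in[5,e-4]$; $\{x_{e-2}^3-x_{e-4}x_{e-1}^2,\ x_2x_{e-2}^2-x_0x_{e-1}^2,\ x_0x_{e-2}^2-x_2x_{e-5}x_{e-1}\}$ if $n=e-3$. - $m=2$: $\{x_0x_4x_{e-3}-x_1^2x_{e-1}\}$ if $n=3$; $\{x_0x_3x_{e-2}-x_1^2x_{e-1},\ x_0x_{n+1}x_{e-2}-x_1x_{n-1}x_{e-1}\}$ if $n\in\{4,5\}$; $\{x_0x_{n+1}x_{e-2}-x_1x_{n-1}x_{e-1},\ x_0x_3x_{e-2}-x_1^2x_{e-1},\ x_1^2x_{n-1}-x_{n+2}x_{e-1}\}$ if $n\in[6,e-4]$; $\{x_{e-2}^3-x_{e-4}x_{e-1}^2,\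 x_3x_{e-2}^2-x_1x_{e-1}^2,\ x_0x_{e-2}^2-x_1x_{e-4}x_{e-1},\ x_0x_3x_{e-2}-x_1^2x_{e-1},\ x_1^2x_{e-4}-x_{e-1}^2\}$ if $n=e-3$; $\{x_0x_4x_{e-3}-x_1^2x_{e-1},\ x_1^2x_{e-3}-x_0^2x_{e-1}\}$ if $n=e-2$. - $m\in[3,e-6]$: $\{x_0x_{m+2}x_{e-3}-x_1x_{m-1}x_{e-1},\ x_0x_{n+1}x_{e-2}-x_2x_{n-2}x_{e-1}\}$ if $n<e-3$ and $n=m+1$; $\{x_0x_{m+1}x_{e-2}-x_1x_{m-1}x_{e-1},\ x_0x_{n+1}x_{e-2}-x_1x_{n-1}x_{e-1}\}$ if $n<e-3$ and $n\ne m+1$; $\{x_{e-2}^3-x_{e-4}x_{e-1}^2,\ x_{m+1}x_{e-2}^2-x_{m-1}x_{e-1}^2,\ x_0x_{e-2}^2-x_1x_{e-4}x_{e-1},\ x_0x_{m+1}x_{e-2}-x_1x_{m-1}x_{e-1}\}$ if $n=e-3$; $\{x_0x_{m+2}x_{e-3}-x_1x_{m-1}x_{e-1}\}$ if $n=e-2$. - $m=e-5$: $\{x_{e-3}^2x_{e-2}-x_{e-6}x_{e-1}^2,\ x_0x_{e-3}x_{e-2}-x_2x_{e-6}x_{e-1},\ x_{e-3}^3-x_{e-7}x_{e-1}^2,\ x_0x_{e-3}^2-x_1x_{e-6}x_{e-1}\}$ if $n=e-4$; $\{x_{e-2}^3-x_{e-4}x_{e-1}^2,\ x_{e-4}x_{e-2}^2-x_{e-6}x_{e-1}^2,\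 x_0x_{e-2}^2-x_1x_{e-4}x_{e-1},\ x_0x_{e-4}x_{e-2}-x_1x_{e-6}x_{e-1}\}$ if $n=e-3$; $\{x_{e-3}^3-x_{e-7}x_{e-1}^2,\ x_1x_{e-3}^2-x_0x_{e-4}x_{e-1},\ x_0x_{e-3}^2-x_1x_{e-6}x_{e-1}\}$ if $n=e-2$. - $(m,n)=(e-4,e-2)$ and $(m,n)=(e-3,e-2)$: $\emptyset$. *)

(* Defs.v *)
From HB Require Import structures.
From mathcomp Require Import all_boot all_order all_algebra.
From mathcomp.multinomials Require Import mpoly.

Set Implicit Arguments.
Unset Strict Implicit.
Unset Printing Implicit Defensive.

Import Order.TTheory GRing.Theory Num.Theory.
Local Open Scope ring_scope.

(* The order on 'X_{1..N} provided by mpoly is the graded LEXICOGRAPHIC one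
   (its header notwithstanding), hence this definition: with 'X_0 > 'X_1 > ...,
   a < b iff deg a < deg b, or the degrees agree and the last nonzero entry of
   b - a is negative. *)
Definition grevlex_lt (N : nat) : rel 'X_{1..N} := fun a b =>
  (mdeg a < mdeg b)%N ||
  (mdeg a == mdeg b) &&
  [exists i : 'I_N, (b i < a i)%N &&
    [forall j : 'I_N, (i < j)%N ==> (a j == b j)]].

Section Groebner.
Variables (K : fieldType) (N : nat) (lt : rel 'X_{1..N}).
Implicit Types (S I : {mpoly K[N]} -> Prop) (G : seq {mpoly K[N]}).

Definition is_lead (p : {mpoly K[N]}) (m : 'X_{1..N}) : Prop :=
  m \in msupp p /\ (forall m', m' \in msupp p -> m' != m -> lt m' m).

Definition lead_terms S (t : {mpoly K[N]}) : Prop :=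
  exists p m, [/\ S p, is_lead p m & t = p@_m *: 'X_[m]].

Definition ideal_gen S (f : {mpoly K[N]}) : Prop :=
  exists2 s : seq ({mpoly K[N]} * {mpoly K[N]}),
    (forall c, c \in s -> S c.2) & f = \sum_(c <- s) c.1 * c.2.

Definition groebner_basis I G : Prop :=
  (forall g, g \in G -> I g) /\
  (forall f, ideal_gen (lead_terms I) f <->
             ideal_gen (lead_terms (fun g => g \in G)) f).
End Groebner.

Definition vars (e m n : nat) : seq nat :=
  [seq i <- iota 0 e | (i != m) && (i != n)].

(* The variable 'X_j of this ring is x_i with i = nth 0 (vars e m n) j; as
   vars is increasing, 'X_0 > 'X_1 > ... is x_0 > ... > x_(e-1). *)
Notation semigroup_ring K e m n := {mpoly K[size (vars e m n)]}.

(* x_i; the sum has exactly one term for i in vars, and is 0 for the other i,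
   which never occur in the sets below. *)
Definition xvar (K : fieldType) (e m n : nat) (i : int) :
    semigroup_ring K e m n :=
  \sum_(j < size (vars e m n) | (nth 0%N (vars e m n) j)%:Z == i) 'X_j.

Definition semigroup_map (K : fieldType) (e m n : nat)
    (p : semigroup_ring K e m n) : {poly K} :=
  mmap (@polyC K) (fun j => 'X^(e + nth 0%N (vars e m n) j)) p.

Definition semigroup_ideal (K : fieldType) (e m n : nat)
    (p : semigroup_ring K e m n) : Prop := semigroup_map p = 0.

Definition irange (a b : int) : seq int :=
  if a <= b then [seq a + k%:Z | k <- iota 0 (absz (b - a)).+1] else [::].

Lemma mem_irange (a b i : int) : (i \in irange a b) = (a <= i <= b).
Proof.
rewrite /irange; case: leP => [le_ab|lt_ba]; last first.
  rewrite in_nil; apply/esym/negbTE/negP => /andP[ai ib].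
  by move: (le_trans ai ib); rewrite leNgt lt_ba.
apply/mapP/andP => [[k]|[ai ib]].
  rewrite mem_iota add0n /= ltnS => kb ->.
  by rewrite lerDl -lerBrDl -(gez0_abs (_ : 0 <= b - a)) ?subr_ge0.
exists (absz (i - a)); last by rewrite gez0_abs ?subr_ge0 // subrKC.
rewrite mem_iota add0n /= ltnS -lez_nat !gez0_abs ?subr_ge0 //.
by rewrite lerD2r.
Qed.

Section GeneratingSets.
Variables (R : pzRingType) (x : int -> R).
Implicit Types (e m n : int) (c d : R * R) (A : seq (R * R)).

(* A matrix with two rows is the list of its columns (top, bottom). *)
Definition minor2 c d : R := c.1 * d.2 - d.1 * c.2.

Fixpoint minors A : seq R :=
  if A is c :: A' then [seq minor2 c d | d <- A'] ++ minors A' else [::].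

Definition first_col_minors A : seq R :=
  if A is c :: A' then [seq minor2 c d | d <- A'] else [::].

Definition cols (k a b : int) : seq (R * R) :=
  [seq (x i, x (i + k)) | i <- irange a b].

Definition A1 e n : seq (R * R) :=
  cols 1 2 (n - 2) ++ cols 1 (n + 1) (e - 2) ++ [:: (x (e - 1), x 0 ^+ 2)].

Definition B1 e n : seq (R * R) :=
  if n == 2 then
    [:: (x 0, x 3)] ++ cols 3 3 (e - 4) ++ [:: (x (e - 3), x 0 ^+ 2)]
  else
    [:: (x 0, x 2)] ++ cols 2 2 (n - 3) ++ [:: (x (n - 1), x (n + 1))]
    ++ cols 2 (n + 1) (e - 3)
    ++ (if n != e - 2 then [:: (x (e - 2), x 0 ^+ 2)] else [::]).

Definition L1 e n : seq R :=
  if n == 2 then [::]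
  else if n == 3 then
    [seq x 4 * x (4 + i) - x 2 * x (6 + i) | i <- irange 0 (e - 7)]
    ++ [:: x 0 ^+ 2 * x 2 - x 4 * x (e - 2)]
  else if n == 4 then
    [seq x 5 * x (5 + i) - x 3 * x (7 + i) | i <- irange 0 (e - 8)]
    ++ [:: x 3 ^+ 2 - x 0 * x 6;
           x 0 ^+ 2 * x 3 - x 5 * x (e - 2);
           x 0 * x 2 ^+ 2 - x 5 * x (e - 1);
           x 2 ^+ 3 - x 7 * x (e - 1)]
  else if 5 <= n <= e - 4 then
    [seq x (n + 1) * x (n + 1 + i) - x (n - 1) * x (n + 3 + i)
       | i <- irange 0 (e - n - 4)]
    ++ [seq x (n - 1) * x (n - 1 - i) - x (n + 1) * x (n - 3 - i)
          | i <- irange 0 (n - 5)]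
    ++ [:: x (n - 1) * x 3 - x (n + 2) * x 0;
           x 0 ^+ 2 * x (n - 1) - x (n + 1) * x (e - 2);
           x 0 * x 2 * x (n - 2) - x (n + 1) * x (e - 1)]
  else if n == e - 3 then
    [seq x (e - 4) * x (e - 4 - i) - x (e - 2) * x (e - 6 - i)
       | i <- irange 0 (e - 8)]
    ++ [:: x (e - 4) * x 3 - x 0 * x (e - 1);
           x 0 ^+ 2 * x (e - 4) - x (e - 2) ^+ 2;
           x 0 * x 2 * x (e - 5) - x (e - 2) * x (e - 1)]
  else if n == e - 2 then
    [seq x (e - 3) * x (e - 3 - i) - x (e - 1) * x (e - 5 - i)
       | i <- irange 0 (e - 7)]
    ++ [:: x 0 ^+ 3 - x 3 * x (e - 3);
           x 0 * x 2 * x (e - 4) - x (e - 1) ^+ 2]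
  else [::].

Definition A2 e m n : seq (R * R) :=
  cols 1 0 (m - 2) ++ cols 1 (m + 1) (n - 2) ++ cols 1 (n + 1) (e - 2)
  ++ [:: (x (e - 1), x 0 ^+ 2)].

Definition K2 e m n : seq R :=
  if (m == 2) && (n == 3) then
    [seq x (n + 1) * x (n + 1 + j) - x (n - 2) * x (n + 4 + j)
       | j <- irange 0 (e - n - 5)]
    ++ [:: x 0 ^+ 2 * x (m - 1) - x (m + 3) * x (e - 4);
           x 0 * x 1 * x (m - 1) - x (m + 3) * x (e - 3);
           x 1 ^+ 3 - x 4 * x (e - 1)]
  else if (m == 2) && (n == 4) then
    [seq x (m + 1) * x (m + 1 + j) - x (m - 1) * x (m + 3 + j)
       | j <- irange 0 (e - m - 4) & j != 1]
    ++ [seq x (n + 1) * x (n + 1 + j) - x (n - 1) * x (n + 3 + j)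
          | j <- irange 0 (e - n - 4)]
    ++ [:: x 0 ^+ 2 * x (m - 1) - x (m + 1) * x (e - 2);
           x 0 * x 1 * x (m - 1) - x (m + 1) * x (e - 1);
           x 0 * x 1 * x (n - 1) - x (n + 2) * x (e - 2);
           x 0 ^+ 2 * x (n - 1) - x (n + 2) * x (e - 3);
           x 1 ^+ 3 - x 6 * x (e - 3);
           x 1 ^+ 2 * x (n - 1) - x (n + 2) * x (e - 1)]
  else if (m == 2) && (n == 5) then
    [:: x (m + 1) ^+ 2 - x (m - 2) * x (m + 4)]
    ++ [seq x (m + 1) * x (m + 1 + j) - x (m - 1) * x (m + 3 + j)
          | j <- irange 1 (e - m - 4) & j != 2]
    ++ [seq x (n + 1) * x (n + 1 + j) - x (n - 1) * x (n + 3 + j)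
          | j <- irange 0 (e - n - 4)]
    ++ [:: x (n - 1) ^+ 2 - x (n + 2) * x (n - 4)]
    ++ [:: x 0 * x 1 * x (n - 1) - x (n + 2) * x (e - 2);
           x 0 ^+ 2 * x (n - 1) - x (n + 2) * x (e - 3);
           x 1 ^+ 2 * x (n - 1) - x (n + 2) * x (e - 1);
           x 0 ^+ 2 * x (m - 1) - x (m + 2) * x (e - 3);
           x 0 * x 1 * x (m - 1) - x (m + 2) * x (e - 2);
           x 1 ^+ 3 - x 4 * x (e - 1)]
  else if (m == 2) && (6 <= n <= e - 4) then
    [:: x (m + 1) * x (n - 2) - x 0 * x (n + 1)]
    ++ [seq x (m + 1) * x (m + 1 + j) - x (m - 1) * x (m + 3 + j)
          | j <- irange 0 (e - m - 4) & j \notin [:: n - m - 1; n - m - 3]]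
    ++ [seq x (n + 1) * x (n + 1 + j) - x (n - 1) * x (n + 3 + j)
          | j <- irange 0 (e - n - 4)]
    ++ [seq x (n - 1) * x (n - 1 - j) - x (n + 1) * x (n - 3 - j)
          | j <- irange 0 (n - m - 4)]
    ++ [:: x (n - 1) * x (m + 2) - x (n + 2) * x (m - 1)]
    ++ [:: x 0 * x 1 * x (n - 1) - x (n + 2) * x (e - 2);
           x 0 ^+ 2 * x (n - 1) - x (n + 2) * x (e - 3);
           x 0 ^+ 2 * x (m - 1) - x (m + 2) * x (e - 3);
           x 0 * x 1 * x (m - 1) - x (m + 2) * x (e - 2);
           x 1 ^+ 3 - x 4 * x (e - 1)]
  else if (m == 2) && (n == e - 3) then
    [:: x (m + 1) * x (n - 2) - x 0 * x (n + 1)]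
    ++ [seq x (m + 1) * x (m + 1 + j) - x (m - 1) * x (m + 3 + j)
          | j <- irange 0 (e - m - 5) & j != n - m - 3]
    ++ [seq x (n - 1) * x (n - 1 - j) - x (n + 1) * x (n - 3 - j)
          | j <- irange 0 (n - m - 4)]
    ++ [:: x (n - 1) * x (m + 2) - x (n + 2) * x (m - 1)]
    ++ [:: x 0 * x 1 * x (n - 1) - x (n + 1) * x (e - 1);
           x 0 ^+ 2 * x (n - 1) - x (n + 1) * x (e - 2);
           x 0 ^+ 2 * x (m - 1) - x (m + 3) * x (e - 4);
           x 0 * x 1 * x (m - 1) - x (m + 2) * x (e - 2);
           x 1 ^+ 3 - x 4 * x (e - 1)]
  else if (m == 2) && (n == e - 2) then
    [:: x (m + 1) * x (n - 2) - x 0 * x (n + 1)]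
    ++ [seq x (m + 1) * x (m + 1 + j) - x (m - 1) * x (m + 3 + j)
          | j <- irange 0 (e - m - 4) & j != n - m - 3]
    ++ [seq x (n - 1) * x (n - 1 - j) - x (n + 1) * x (n - 3 - j)
          | j <- irange 0 (n - m - 4)]
    ++ [:: x 0 * x 1 * x (n - 1) - x (n + 1) * x (e - 1);
           x 0 ^+ 2 * x (m - 1) - x (m + 2) * x (e - 3);
           x 0 * x 1 * x (m - 1) - x (m + 3) * x (e - 3);
           x 1 ^+ 3 - x 4 * x (e - 1)]
  else if (m == 3) && (n == 4) then
    [seq x (n + 1) * x (n + 1 + j) - x (n - 2) * x (n + 4 + j)
       | j <- irange 0 (e - n - 5)]
    ++ [:: x 0 ^+ 2 * x (m - 1) - x (m + 3) * x (e - 4);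
           x 0 * x 1 * x (m - 1) - x (m + 3) * x (e - 3);
           x 0 * x 2 * x (n - 2) - x (n + 2) * x (e - 2);
           x 2 ^+ 2 * x 1 - x 6 * x (e - 1);
           x 2 ^+ 3 - x 7 * x (e - 1)]
  else if (4 <= m <= e - 6) && (n == m + 1) then
    [seq x (n + 1) * x (n + 1 + j) - x (n - 2) * x (n + 4 + j)
       | j <- irange 0 (e - n - 5)]
    ++ [seq x (m - 1) * x (m - 1 - j) - x (m + 2) * x (m - 4 - j)
          | j <- irange 0 (m - 4)]
    ++ [:: x 0 ^+ 2 * x (m - 1) - x (m + 2) * x (e - 3);
           x 0 * x 1 * x (m - 1) - x (m + 2) * x (e - 2);
           x 0 * x 2 * x (n - 2) - x (n + 2) * x (e - 2)]
  else if (m == e - 5) && (n == e - 4) then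
    [seq x (m - 1) * x (m - 1 - j) - x (m + 2) * x (m - 4 - j)
       | j <- irange 0 (m - 4)]
    ++ [:: x 0 ^+ 2 * x (m - 1) - x (m + 2) * x (e - 3);
           x 0 * x 1 * x (m - 1) - x (m + 2) * x (e - 2);
           x 0 * x 2 * x (n - 2) - x (n + 2) * x (e - 2)]
  else if (m == e - 3) && (n == e - 2) then
    [seq x (m - 1) * x (m - 1 - j) - x (m + 2) * x (m - 4 - j)
       | j <- irange 0 (m - 4)]
    ++ [:: x 0 * x 2 * x (n - 2) - x (n + 1) * x (e - 1)]
  else if (3 <= m <= e - 6) && (n == m + 2) then
    [seq x (m + 1) * x (m + 1 + j) - x (m - 1) * x (m + 3 + j)
       | j <- irange 0 (e - m - 4) & j != 1]
    ++ [seq x (n + 1) * x (n + 1 + j) - x (n - 1) * x (n + 3 + j)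
          | j <- irange 0 (e - n - 4)]
    ++ [seq x (n - 1) * x (n - 3 - j) - x (n + 1) * x (n - 5 - j)
          | j <- irange 0 (n - 5)]
    ++ [seq x (m - 1) * x (m - 1 - j) - x (m + 1) * x (m - 3 - j)
          | j <- irange 0 (m - 3)]
    ++ [:: x 0 ^+ 2 * x (m - 1) - x (m + 1) * x (e - 2);
           x 0 * x 1 * x (m - 1) - x (m + 1) * x (e - 1);
           x 0 * x 1 * x (n - 1) - x (n + 2) * x (e - 2);
           x 0 ^+ 2 * x (n - 1) - x (n + 2) * x (e - 3)]
  else if (m == e - 5) && (n == e - 3) then
    [:: x (m + 1) ^+ 2 - x (m - 1) * x (m + 3)]
    ++ [seq x (n - 1) * x (n - 3 - j) - x (n + 1) * x (n - 5 - j)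
          | j <- irange 0 (n - 5)]
    ++ [seq x (m - 1) * x (m - 1 - j) - x (m + 1) * x (m - 3 - j)
          | j <- irange 0 (m - 3)]
    ++ [:: x 0 ^+ 2 * x (m - 1) - x (m + 1) * x (e - 2);
           x 0 * x 1 * x (m - 1) - x (m + 1) * x (e - 1);
           x 0 * x 1 * x (n - 1) - x (n + 2) * x (e - 2);
           x 0 ^+ 2 * x (n - 1) - x (n + 1) * x (e - 2)]
  else if (m == e - 4) && (n == e - 2) then
    [:: x (m + 1) ^+ 2 - x (m - 1) * x (m + 3)]
    ++ [seq x (n - 1) * x (n - 3 - j) - x (n + 1) * x (n - 5 - j)
          | j <- irange 0 (n - 5)]
    ++ [seq x (m - 1) * x (m - 1 - j) - x (m + 1) * x (m - 3 - j)
          | j <- irange 0 (m - 3)]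
    ++ [:: x 0 * x 1 * x (m - 1) - x (m + 1) * x (e - 1);
           x 0 * x 1 * x (n - 1) - x (n + 1) * x (e - 1)]
  else if (3 <= m) && (m + 2 < n <= e - 4) then
    [:: x (m + 1) * x (n - 2) - x (m - 2) * x (n + 1)]
    ++ [seq x (m + 1) * x (m + 1 + j) - x (m - 1) * x (m + 3 + j)
          | j <- irange 0 (e - m - 4) & j \notin [:: n - m - 1; n - m - 3]]
    ++ [seq x (n + 1) * x (n + 1 + j) - x (n - 1) * x (n + 3 + j)
          | j <- irange 0 (e - n - 4)]
    ++ [seq x (n - 1) * x (n - 1 - j) - x (n + 1) * x (n - 3 - j)
          | j <- irange 0 (n - 3)
          & j \notin [:: n - m - 1; n - m - 2; n - m - 3]]
    ++ [:: x (n - 1) * x (m + 2) - x (n + 2) * x (m - 1)]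
    ++ [seq x (m - 1) * x (m - 1 - j) - x (m + 1) * x (m - 3 - j)
          | j <- irange 0 (m - 3)]
    ++ [:: x 0 ^+ 2 * x (m - 1) - x (m + 2) * x (e - 3);
           x 0 * x 1 * x (m - 1) - x (m + 2) * x (e - 2);
           x 0 * x 1 * x (n - 1) - x (n + 2) * x (e - 2);
           x 0 ^+ 2 * x (n - 1) - x (n + 2) * x (e - 3)]
  else if [&& 3 <= m, m + 2 < n & n == e - 3] then
    [:: x (m + 1) * x (n - 2) - x (m - 2) * x (n + 1)]
    ++ [seq x (m + 1) * x (m + 1 + j) - x (m - 1) * x (m + 3 + j)
          | j <- irange 0 (e - m - 4) & j \notin [:: n - m - 1; n - m - 3]]
    ++ [seq x (n - 1) * x (n - 1 - j) - x (n + 1) * x (n - 3 - j)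
          | j <- irange 0 (n - 3)
          & j \notin [:: n - m - 1; n - m - 2; n - m - 3]]
    ++ [:: x (n - 1) * x (m + 2) - x (n + 2) * x (m - 1)]
    ++ [seq x (m - 1) * x (m - 1 - j) - x (m + 1) * x (m - 3 - j)
          | j <- irange 0 (m - 3)]
    ++ [:: x 0 ^+ 2 * x (m - 1) - x (m + 1) * x (e - 2);
           x 0 * x 1 * x (m - 1) - x (m + 1) * x (e - 1);
           x 0 * x 1 * x (n - 1) - x (n + 2) * x (e - 2);
           x 0 ^+ 2 * x (n - 1) - x (n + 1) * x (e - 2)]
  else if [&& 3 <= m, m + 2 < n & n == e - 2] then
    [:: x (m + 1) * x (n - 2) - x (m - 2) * x (n + 1)]
    ++ [seq x (m + 1) * x (m + 1 + j) - x (m - 1) * x (m + 3 + j)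
          | j <- irange 0 (e - m - 4) & j != n - m - 3]
    ++ [seq x (n - 1) * x (n - 1 - j) - x (n + 1) * x (n - 3 - j)
          | j <- irange 0 (n - 3)
          & j \notin [:: n - m - 1; n - m - 2; n - m - 3]]
    ++ [seq x (m - 1) * x (m - 1 - j) - x (m + 1) * x (m - 3 - j)
          | j <- irange 0 (m - 3)]
    ++ [:: x 0 ^+ 2 * x (m - 1) - x (m + 2) * x (e - 3);
           x 0 * x 1 * x (m - 1) - x (m + 1) * x (e - 1);
           x 0 * x 1 * x (n - 1) - x (n + 1) * x (e - 1)]
  else [::].

Definition G e m n : seq R :=
  if m == 1 then minors (A1 e n) ++ first_col_minors (B1 e n) ++ L1 e n
  else minors (A2 e m n) ++ K2 e m n.

Definition G' e m n : seq R :=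
  if m == 1 then
    if n \in [:: 2; 3; e - 2] then [::]
    else if n == 4 then
      [:: x 0 * x 5 * x (e - 2) - x 2 ^+ 2 * x (e - 1);
          x 2 ^+ 2 * x (e - 2) - x 0 * x 3 * x (e - 1)]
    else if 5 <= n <= e - 4 then
      [:: x 0 * x (n + 1) * x (e - 2) - x 2 * x (n - 2) * x (e - 1)]
    else if n == e - 3 then
      [:: x (e - 2) ^+ 3 - x (e - 4) * x (e - 1) ^+ 2;
          x 2 * x (e - 2) ^+ 2 - x 0 * x (e - 1) ^+ 2;
          x 0 * x (e - 2) ^+ 2 - x 2 * x (e - 5) * x (e - 1)]
    else [::]
  else if m == 2 then
    if n == 3 then
      [:: x 0 * x 4 * x (e - 3) - x 1 ^+ 2 * x (e - 1)]
    else if n \in [:: 4; 5] then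
      [:: x 0 * x 3 * x (e - 2) - x 1 ^+ 2 * x (e - 1);
          x 0 * x (n + 1) * x (e - 2) - x 1 * x (n - 1) * x (e - 1)]
    else if 6 <= n <= e - 4 then
      [:: x 0 * x (n + 1) * x (e - 2) - x 1 * x (n - 1) * x (e - 1);
          x 0 * x 3 * x (e - 2) - x 1 ^+ 2 * x (e - 1);
          x 1 ^+ 2 * x (n - 1) - x (n + 2) * x (e - 1)]
    else if n == e - 3 then
      [:: x (e - 2) ^+ 3 - x (e - 4) * x (e - 1) ^+ 2;
          x 3 * x (e - 2) ^+ 2 - x 1 * x (e - 1) ^+ 2;
          x 0 * x (e - 2) ^+ 2 - x 1 * x (e - 4) * x (e - 1);
          x 0 * x 3 * x (e - 2) - x 1 ^+ 2 * x (e - 1);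
          x 1 ^+ 2 * x (e - 4) - x (e - 1) ^+ 2]
    else if n == e - 2 then
      [:: x 0 * x 4 * x (e - 3) - x 1 ^+ 2 * x (e - 1);
          x 1 ^+ 2 * x (e - 3) - x 0 ^+ 2 * x (e - 1)]
    else [::]
  else if 3 <= m <= e - 6 then
    if (n < e - 3) && (n == m + 1) then
      [:: x 0 * x (m + 2) * x (e - 3) - x 1 * x (m - 1) * x (e - 1);
          x 0 * x (n + 1) * x (e - 2) - x 2 * x (n - 2) * x (e - 1)]
    else if (n < e - 3) && (n != m + 1) then
      [:: x 0 * x (m + 1) * x (e - 2) - x 1 * x (m - 1) * x (e - 1);
          x 0 * x (n + 1) * x (e - 2) - x 1 * x (n - 1) * x (e - 1)]
    else if n == e - 3 then
      [:: x (e - 2) ^+ 3 - x (e - 4) * x (e - 1) ^+ 2;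
          x (m + 1) * x (e - 2) ^+ 2 - x (m - 1) * x (e - 1) ^+ 2;
          x 0 * x (e - 2) ^+ 2 - x 1 * x (e - 4) * x (e - 1);
          x 0 * x (m + 1) * x (e - 2) - x 1 * x (m - 1) * x (e - 1)]
    else if n == e - 2 then
      [:: x 0 * x (m + 2) * x (e - 3) - x 1 * x (m - 1) * x (e - 1)]
    else [::]
  else if m == e - 5 then
    if n == e - 4 then
      [:: x (e - 3) ^+ 2 * x (e - 2) - x (e - 6) * x (e - 1) ^+ 2;
          x 0 * x (e - 3) * x (e - 2) - x 2 * x (e - 6) * x (e - 1);
          x (e - 3) ^+ 3 - x (e - 7) * x (e - 1) ^+ 2;
          x 0 * x (e - 3) ^+ 2 - x 1 * x (e - 6) * x (e - 1)]
    else if n == e - 3 then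
      [:: x (e - 2) ^+ 3 - x (e - 4) * x (e - 1) ^+ 2;
          x (e - 4) * x (e - 2) ^+ 2 - x (e - 6) * x (e - 1) ^+ 2;
          x 0 * x (e - 2) ^+ 2 - x 1 * x (e - 4) * x (e - 1);
          x 0 * x (e - 4) * x (e - 2) - x 1 * x (e - 6) * x (e - 1)]
    else if n == e - 2 then
      [:: x (e - 3) ^+ 3 - x (e - 7) * x (e - 1) ^+ 2;
          x 1 * x (e - 3) ^+ 2 - x 0 * x (e - 4) * x (e - 1);
          x 0 * x (e - 3) ^+ 2 - x 1 * x (e - 6) * x (e - 1)]
    else [::]
  else [::].

Definition calG e m n : seq R := G e m n ++ G' e m n.
End GeneratingSets.

(* Main.v *)
Require Import Defs.
From HB Require Import structures.
From mathcomp Require Import all_boot all_order all_algebra.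
From mathcomp.multinomials Require Import mpoly.
From mathcomp Require Import zify ring.
From Stdlib Require Zify.
From Stdlib Require Import Classical_Prop.
Import Order.TTheory GRing.Theory Num.Theory.
Local Open Scope ring_scope.

(** Why the theorem holds.  The ideal I is spanned by differences of monomials
    of equal weight, the weight of x_i being e + i.  Hence a set G of elements
    of I is a Groebner basis as soon as no two distinct monomials that avoid
    the leading monomials of G have the same weight: if f in I had a leading
    monomial a avoiding them, some smaller monomial of f would have the weight
    of a, and replacing leading monomials of G by the other term as long as
    possible would turn it into a second avoiding monomial of this weight.

    It remains to list the monomials avoiding the leading monomials of calG.
    Write such a monomial as b x_(e-1)^k with b free of x_(e-1), the generator
    of the largest weight 2e - 1; then b avoids them, too.  Modulo 2e - 1 the
    weights of 1, of x_i (e + i) and of x_0 x_j (j + 1) run through all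
    residues except those lost with the two missing generators: e + m, e + n,
    m + 1 and n + 1.  For these four residues there are four explicit
    exceptional monomials of degree 2 or 3 (the stand-ins [stand_m],
    [stand_n], [stand_0m], [stand_0n] below), given by the same formulas for
    all (m, n).  The claim is that an avoiding b is one of these 2e - 1
    monomials (lemma [classification]); then b is determined by its residue
    ([standard_inj]) and k by the weight ([reduced_unique]).

    A monomial is handled as the sorted list of its indices.  A product x_i x_j
    with 1 <= i <= j <= e - 2 is a leading monomial of a minor of A unless i
    follows a gap (i = m + 1 or n + 1) or j precedes one (j = m - 1 or n - 1),
    and likewise x_0^2 x_k; so only products next to a gap have to be found in
    the other lists ([boundary_complete]).  There every question is one of
    linear arithmetic in e, m, n and the indices, regime by regime.  A cubic
    monomial then only needs attention when all its products of pairs contain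
    x_0 or are exceptional, and no monomial of degree 4 avoids everything
    ([exceptional4F]). *)

Set Implicit Arguments.
Unset Strict Implicit.
Unset Printing Implicit Defensive.

(** * The graded reverse lexicographic order *)

Section Grevlex.
Variable N : nat.
Implicit Types (a b c : 'X_{1..N}).
Local Notation lt := (@grevlex_lt N).

Lemma grevlex_irr a : lt a a = false.
Proof.
rewrite /grevlex_lt ltnn eqxx /=; apply/existsP => -[i].
by rewrite ltnn.
Qed.

Lemma grevlex_trans : transitive lt.
Proof.
move=> b a c /orP[ab|/andP[/eqP ab /existsP[i /andP[bi /forallP ai]]]].
  move=> /orP[bc|/andP[/eqP bc _]]; apply/orP; left.
    exact: ltn_trans ab bc.
  by rewrite -bc.
move=> /orP[bc|/andP[/eqP bc /existsP[j /andP[cj /forallP aj]]]].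
  by apply/orP; left; rewrite ab.
apply/orP; right; rewrite ab bc eqxx /=; apply/existsP.
have eqi (k : 'I_N) : (i < k)%N -> a k = b k by move=> ik; apply/eqP/(implyP (ai k)).
have eqj (k : 'I_N) : (j < k)%N -> b k = c k by move=> jk; apply/eqP/(implyP (aj k)).
have [ij|ji|ij] := ltngtP i j.
- exists j; rewrite eqi // cj /=; apply/forallP => k; apply/implyP => jk.
  by rewrite eqi ?eqj // (ltn_trans ij jk).
- exists i; rewrite -eqj // bi /=; apply/forallP => k; apply/implyP => ik.
  by rewrite eqi ?eqj // (ltn_trans ji ik).
- have {ij}ij : i = j by apply: val_inj.
  exists i; rewrite (ltn_trans _ bi) ?ij //=; apply/forallP => k.
  by apply/implyP => ik; rewrite eqi ?eqj // ij.
Qed.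

Lemma grevlex_add2r c a b : lt (a + c)%MM (b + c)%MM = lt a b.
Proof.
rewrite /grevlex_lt !mdegD ltn_add2r eqn_add2r; congr (_ || _ && _).
apply: eq_existsb => i; rewrite !mnmDE ltn_add2r; congr (_ && _).
by apply: eq_forallb => j; rewrite !mnmDE eqn_add2r.
Qed.

Lemma grevlex_mdeg a b : lt a b -> (mdeg a <= mdeg b)%N.
Proof. by case/orP => [/ltnW//|/andP[/eqP-> _]]. Qed.

(** Only finitely many monomials have degree at most that of a, so replacing a
    monomial by a smaller one ends; Q is where it stops. *)
Lemma grevlex_descent (P Q : 'X_{1..N} -> Prop) :
  (forall a, P a -> Q a \/ exists2 b, P b & lt b a) ->
  forall a, P a -> exists b, [/\ P b, Q b & b = a \/ lt b a].
Proof.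
move=> step a Pa; pose d := (mdeg a).+1.
pose below (b : 'X_{1..N}) := #|[pred c : 'X_{1..N < d} | lt (c : 'X_{1..N}) b]|.
suff H k a' : P a' -> (mdeg a' < d)%N -> (below a' < k)%N ->
    exists b, [/\ P b, Q b & b = a' \/ lt b a'].
  exact: (H _ a Pa (ltnSn _) (ltnSn _)).
elim: k a' => // k IH c Pc cd; rewrite ltnS => ck.
case: (step c Pc) => [Qc|[b Pb ltbc]]; first by exists c; split; auto.
have bd : (mdeg b < d)%N := leq_ltn_trans (grevlex_mdeg ltbc) cd.
have [] := IH b Pb bd.
  apply: leq_trans ck; apply: proper_card; apply/properP; split.
    by apply/subsetP => z; rewrite !inE => /grevlex_trans; apply.
  by exists (BMultinom bd); rewrite !inE //= grevlex_irr.
move=> z [Pz Qz zb]; exists z; split=> //; right.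
by case: zb => [->//|zb]; apply: grevlex_trans ltbc.
Qed.
End Grevlex.

(** * A criterion for Groebner bases *)

Section Criterion.
Variables (K : fieldType) (N : nat) (lt : rel 'X_{1..N}).
Implicit Types (S I : {mpoly K[N]} -> Prop).

Lemma ideal_genD S f g : ideal_gen S f -> ideal_gen S g -> ideal_gen S (f + g).
Proof.
move=> [s sS ->] [t tS ->]; exists (s ++ t); last by rewrite big_cat.
by move=> c; rewrite mem_cat => /orP[/sS|/tS].
Qed.

Lemma ideal_genM S q f : ideal_gen S f -> ideal_gen S (q * f).
Proof.
move=> [s sS ->]; exists [seq (q * c.1, c.2) | c <- s].
  by move=> _ /mapP[c /sS Sc ->].
by rewrite big_map big_distrr /=; apply: eq_bigr => c _; rewrite mulrA.
Qed.

Lemma ideal_gen0 S : ideal_gen S 0.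
Proof. by exists [::] => //; rewrite big_nil. Qed.

Lemma ideal_gen_sub S I :
  (forall t, S t -> ideal_gen I t) -> forall f, ideal_gen S f -> ideal_gen I f.
Proof.
move=> SI f [s sS ->]; elim: s sS => [_|c s IH sS].
  by rewrite big_nil; apply: ideal_gen0.
rewrite big_cons; apply: ideal_genD.
  by apply/ideal_genM/SI/sS; rewrite inE eqxx.
by apply: IH => d ds; apply: sS; rewrite inE ds orbT.
Qed.

Lemma groebner_of_leads I (G : seq {mpoly K[N]}) :
  (forall g, g \in G -> I g) ->
  (forall f a, I f -> is_lead lt f a ->
    exists g b, [/\ g \in G, is_lead lt g b & (b <= a)%MM]) ->
  groebner_basis lt I G.
Proof.
move=> GI lead; split=> // f; split; apply: ideal_gen_sub => t [p [a [Ip la ->]]].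
  have [g [b [gG lb ba]]] := lead p a Ip la.
  exists [:: ((p@_a / g@_b) *: 'X_[a - b], g@_b *: 'X_[b])].
    by move=> c; rewrite inE => /eqP->; exists g, b; split.
  rewrite big_seq1 /= -scalerAl -scalerAr scalerA -mpolyXD submK //.
  by rewrite divfK //; case: lb => + _; rewrite mcoeff_msupp.
exists [:: (1, p@_a *: 'X_[a])]; last by rewrite big_seq1 mul1r.
by move=> c; rewrite inE => /eqP->; exists p, a; split=> //; apply: GI.
Qed.

(** The sign is left open because the minors of the matrices carry their leading
    monomial sometimes in the first and sometimes in the second term. *)
Lemma is_lead_binomial (a b : 'X_{1..N}) : lt b a -> b != a ->
  is_lead lt ('X_[a] - 'X_[b] : {mpoly K[N]}) a /\
  is_lead lt ('X_[b] - 'X_[a] : {mpoly K[N]}) a.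
Proof.
move=> ba neq; have sw : ('X_[b] - 'X_[a] : {mpoly K[N]}) = - ('X_[a] - 'X_[b]).
  by rewrite opprB.
have L : is_lead lt ('X_[a] - 'X_[b] : {mpoly K[N]}) a.
  split.
    by rewrite mcoeff_msupp mcoeffB !mcoeffX eqxx (negbTE neq) subr0 oner_neq0.
  move=> c; rewrite mcoeff_msupp mcoeffB !mcoeffX => + ca.
  rewrite (eq_sym a) (negbTE ca) sub0r oppr_eq0.
  by case: (b =P c) => [<-//|]; rewrite eqxx.
split=> //; case: L => La Lc; split; first by rewrite sw (perm_mem (msuppN _)).
by move=> c; rewrite sw (perm_mem (msuppN _)); apply: Lc.
Qed.
End Criterion.

(** * Normal forms modulo 2e - 1 *)

Section IndexLists.
Variables (e m n : int).
Implicit Types (u v s : seq int).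

Definition generator i := [&& 0 <= i, i < e, i != m & i != n].
Definition weight u : int := foldr (fun i w => (e + i) + w) 0 u.
Definition same_weight u v :=
  [&& all generator u, all generator v & weight u == weight v].
(** A sufficient condition for the monomial of v to be below that of u: among
    monomials of one degree it is enough that v has an index beyond those of
    u, since x_0 > x_1 > ... . *)
Definition smaller v u : bool :=
  (size v < size u)%N ||
  (size v == size u) && has (fun d => all (fun i => i < d) u) v.

(** The exceptional monomials: [stand_m] and [stand_n] have the residues of the
    missing x_m and x_n modulo 2e - 1, [stand_0m] and [stand_0n] those of
    x_0 x_m and x_0 x_n.  The obvious candidates are x_(m+1) x_(e-2) for
    the former and x_1 x_(m-1) for the latter; the other branches replace them
    where these indices are missing or fall outside the range. *)
Definition stand_m : seq int :=
  if e - 4 <= m then [:: 0; 0; m - 1]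
  else if (n == m + 1) || (n == e - 2) then [:: m + 2; e - 3]
  else [:: m + 1; e - 2].
Definition stand_n : seq int :=
  if n == e - 2 then
    if m == e - 3 then [:: 0; 1; m - 1] else [:: 0; 0; n - 1]
  else [:: n + 1; e - 2].
Definition stand_0m : seq int :=
  if m == 1 then 0 :: stand_m else [:: 1; m - 1].
Definition stand_0n : seq int :=
  if n <= 3 then 0 :: stand_n
  else if (m == 1) || (n == m + 1) then [:: 2; n - 2] else [:: 1; n - 1].
Definition exceptional : seq (seq int) := [:: stand_0m; stand_0n; stand_m; stand_n].

Definition normal_form (r : int) : seq int :=
  if r == 0 then [::]
  else if r == m + 1 then stand_0m
  else if r == n + 1 then stand_0n
  else if r < e then [:: 0; r - 1]
  else if r == e + m then stand_m
  else if r == e + n then stand_n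
  else [:: r - e].

Definition standard s := exists r k,
  [/\ 0 <= r < 2 * e - 1, weight s = r + k * (2 * e - 1) & s = normal_form r].

Hypotheses (he : 10 <= e) (hm : 1 <= m) (hmn : m < n) (hn : n <= e - 2).
Hypothesis hexc : (m != e - 4) || (n != e - 3).

Lemma exceptional_standard s : s \in exceptional -> standard s.
Proof.
have [nm0 nn0 nnm] : [/\ (m + 1 == 0) = false, (n + 1 == 0) = false &
  (n + 1 == m + 1) = false] by split; lia.
have [em0 emm emn eme] : [/\ (e + m == 0) = false, (e + m == m + 1) = false,
  (e + m == n + 1) = false & (e + m < e) = false] by split; lia.
have [en0 enm enn ene] : [/\ (e + n == 0) = false, (e + n == m + 1) = false,
  (e + n == n + 1) = false & (e + n < e) = false] by split; lia.
have enem : (e + n == e + m) = false by lia.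
rewrite !inE => /or4P[] /eqP->.
- exists (m + 1), (if m == 1 then 2 else 1).
  rewrite /normal_form nm0 eqxx; split=> //; first by lia.
  rewrite /stand_0m /stand_m; case: ifP => ?; last by rewrite /weight /=; lia.
  by do ?case: ifP => ?; rewrite /weight /=; lia.
- exists (n + 1), (if n <= 3 then 2 else 1).
  rewrite /normal_form nn0 nnm eqxx; split=> //; first by lia.
  rewrite /stand_0n /stand_n; case: ifP => ?; last first.
    by case: ifP => ?; rewrite /weight /=; lia.
  by do ?case: ifP => ?; rewrite /weight /=; lia.
- exists (e + m), 1; rewrite /normal_form em0 emm emn eme eqxx.
  split=> //; first by lia.
  by rewrite /stand_m; do ?case: ifP => ?; rewrite /weight /=; lia.
- exists (e + n), 1; rewrite /normal_form en0 enm enn ene enem eqxx.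
  split=> //; first by lia.
  by rewrite /stand_n; do ?case: ifP => ?; rewrite /weight /=; lia.
Qed.

Lemma standard_nil : standard [::].
Proof. by exists 0, 0; split; [lia | rewrite mul0r | ]. Qed.

Lemma standard1 i : generator i -> i <= e - 2 -> standard [:: i].
Proof.
move=> /and4P[i0 ie im inn] ie2; exists (e + i), 0.
split; [lia | by rewrite /weight /=; lia | rewrite /normal_form].
do 6 (rewrite ifF; last by lia).
by congr [:: _]; lia.
Qed.

Lemma standard2 j : generator j -> j <= e - 2 -> standard [:: 0; j].
Proof.
move=> /and4P[j0 je jm jn] je2; exists (j + 1), 1.
split; [lia | by rewrite /weight /=; lia | rewrite /normal_form].
do 3 (rewrite ifF; last by lia).
rewrite ifT; last by lia.
by congr [:: _; _]; lia.
Qed.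

(** The weights of s and t are congruent modulo 2e - 1, the weight of x_(e-1), so
    both are the normal form of one residue. *)
Lemma standard_inj s t d : standard s -> standard t ->
  weight s = weight t + d * (2 * e - 1) -> s = t.
Proof.
move=> [r [k [hr ws sE]]] [r' [k' [hr' wt tE]]].
rewrite ws wt => E; rewrite sE tE; congr normal_form.
have /(congr1 (modz^~ (2 * e - 1))) : r + k * (2 * e - 1) =
  r' + (k' + d) * (2 * e - 1) by rewrite E; ring.
by rewrite /= (addrC r) (addrC r') !modzMDl !modz_small //; lia.
Qed.

(** An exceptional triple starts with 0, its second index is less than 5, and if
    that is 0, its last one is at least 5.  So if all triples of i, j, k, l were
    exceptional, then i = j = 0 and k would be both at least 5 and less. *)
Lemma exceptional4F i j k l : i <= j -> j <= k -> k <= l ->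
  [:: i; j; k] \in exceptional -> [:: i; j; l] \in exceptional ->
  [:: i; k; l] \in exceptional -> [:: j; k; l] \in exceptional -> False.
Proof.
have H a b c : [:: a; b; c] \in exceptional ->
    [/\ a = 0, b < 5 & b = 0 -> 5 <= c].
  rewrite !inE /stand_0m /stand_0n /stand_m /stand_n => /or4P[]; do ?case: ifP => ?;
    move=> /eqP // [-> -> ->]; split; lia.
by move=> ij jk kl /H[_ _ h1] _ /H[_ k5 _] /H[/h1 + _ _]; lia.
Qed.

Section Classification.
Variables (R : comPzRingType) (x : int -> R) (G : seq R).
Definition monomial u : R := \prod_(i <- u) x i.

Definition leads u : Prop :=
  exists v, [/\ same_weight u v, smaller v u &
    monomial u - monomial v \in G \/ monomial v - monomial u \in G].

(** That G has enough leading monomials in degrees 2 and 3.  A triple is only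
    asked for when its pairs that are free of x_0 are exceptional: otherwise one
    of these pairs already leads. *)
Definition pairs_complete := forall i j : int, 1 <= i -> i <= j -> j <= e - 2 ->
  generator i -> generator j -> ~ leads [:: i; j] -> [:: i; j] \in exceptional.
Definition triples00_complete := forall k : int, 0 <= k -> k <= e - 2 ->
  generator k -> ~ leads [:: 0; 0; k] -> [:: 0; 0; k] \in exceptional.
Definition triples0_complete := forall j k : int, 1 <= j -> j <= k ->
  [:: j; k] \in exceptional ->
  ~ leads [:: 0; j; k] -> [:: 0; j; k] \in exceptional.
Definition triples_complete := forall i j k : int, 1 <= i -> i <= j -> j <= k ->
  [:: i; j] \in exceptional -> [:: i; k] \in exceptional ->
  [:: j; k] \in exceptional ->
  ~ leads [:: i; j; k] -> False.
Definition complete := [/\ pairs_complete, triples00_complete,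
  triples0_complete & triples_complete].

Hypothesis Gcomplete : complete.

Lemma nonlead2 i j : 0 <= i -> i <= j -> j <= e - 2 -> generator i -> generator j ->
  ~ leads [:: i; j] -> i = 0 \/ 1 <= i /\ [:: i; j] \in exceptional.
Proof.
move=> i0 ij je gi gj nl; have [|i1] := eqVneq i 0; [by left | right].
have i1' : 1 <= i by lia.
by split=> //; have [+ _ _ _] := Gcomplete; apply.
Qed.

Lemma nonlead3 i j k : i <= j -> j <= k -> k <= e - 2 ->
  all generator [:: i; j; k] ->
  (forall u, subseq u [:: i; j; k] -> ~ leads u) -> [:: i; j; k] \in exceptional.
Proof.
move=> ij jk ke /and4P[gi gj gk _] nl; have [_ G00 G0 G3] := Gcomplete.
have i0 : 0 <= i by case/and4P: gi.
have je : j <= e - 2 by lia.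
have ss u : subseq u [:: i; j; k] -> ~ leads u := nl u.
have nij : ~ leads [:: i; j] by apply: ss; rewrite /= !eqxx.
have nik : ~ leads [:: i; k].
  apply: ss; have -> : [:: i; k] = mask [:: true; false; true] [:: i; j; k] by [].
  exact: mask_subseq.
have njk : ~ leads [:: j; k] by apply: ss; exact: (subseq_cons [:: j; k] i).
have nijk : ~ leads [:: i; j; k] by apply: ss.
case: (nonlead2 _ jk ke gj gk njk) => [|j0|[j1 ejk]]; first by lia.
  have ei : i = 0 by lia.
  by move: nijk; rewrite j0 ei; apply: G00 => //; lia.
case: (nonlead2 i0 ij je gi gj nij) => [ei|[i1 eij]].
  by move: nijk; rewrite ei; apply: G0.
have [|[_ eik]] := nonlead2 i0 (le_trans ij jk) ke gi gk nik; first by lia.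
by case: (G3 i j k).
Qed.

(** Up to degree 3 this is completeness; in higher degree the first four indices
    would have only exceptional triples. *)
Lemma classification s : sorted <=%R s -> all generator s ->
  all (fun i => i <= e - 2) s -> (forall u, subseq u s -> ~ leads u) -> standard s.
Proof.
case: s => [|i [|j [|k s]]].
- by move=> *; apply: standard_nil.
- by move=> _ /andP[gi _] /andP[ie _] _; apply: standard1.
- move=> /andP[ij _] /and3P[gi gj _] /and3P[_ je _] nl.
  have i0 : 0 <= i by case/and4P: gi.
  have [] := nonlead2 i0 ij je gi gj (nl _ (subseq_refl _)).
    by move=> ->; apply: standard2.
  by case=> _; apply: exceptional_standard.
case: s => [|l s].
  move=> /and3P[ij jk _] g /and4P[_ _ ke _] nl.
  by apply: exceptional_standard; apply: nonlead3.
move=> /and4P[ij jk kl _] /and5P[gi gj gk gl _] /and5P[ie je ke le _] nl.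
have nl4 u : subseq u [:: i; j; k; l] -> ~ leads u.
  move=> ul; apply: nl; apply: (subseq_trans ul).
  exact: (prefix_subseq [:: i; j; k; l] s).
have sub a b c t : mask t [:: i; j; k; l] = [:: a; b; c] ->
    a <= b -> b <= c -> c <= e - 2 -> all generator [:: a; b; c] ->
    [:: a; b; c] \in exceptional.
  move=> E ab bc ce g; apply: nonlead3 => // u ul; apply: nl4.
  by rewrite -E in ul; apply: subseq_trans ul (mask_subseq _ _).
exfalso; apply: (@exceptional4F i j k l) => //.
- by apply: (sub _ _ _ [:: true; true; true; false]); rewrite //= gi gj gk.
- apply: (sub _ _ _ [:: true; true; false; true]); rewrite //= ?gi ?gj ?gl //.
  by lia.
- apply: (sub _ _ _ [:: true; false; true; true]); rewrite //= ?gi ?gk ?gl //.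
  by lia.
- by apply: (sub _ _ _ [:: false; true; true; true]); rewrite //= gj gk gl.
Qed.
End Classification.
End IndexLists.

(** * Reading leading monomials off the lists *)

Lemma decide_by_contra (b : bool) : (~~ b -> False) -> b.
Proof. by case: b => // /(_ isT). Qed.

Lemma notin_consE (T : eqType) (u v : T) s :
  u \notin v :: s -> u != v /\ u \notin s.
Proof. by rewrite inE negb_or => /andP. Qed.

Lemma in_consE (T : eqType) (u v : T) s : u \in v :: s -> u = v \/ u \in s.
Proof. by rewrite inE => /orP[/eqP|]; auto. Qed.

Lemma neq2 (i j a b : int) :
  [:: i; j] != [:: a; b] -> i = a -> j = b -> False.
Proof. by move=> + ei ej; rewrite ei ej eqxx. Qed.

Lemma neq3 (i j k a b c : int) :
  [:: i; j; k] != [:: a; b; c] -> i = a -> j = b -> k = c -> False.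
Proof. by move=> + ei ej ek; rewrite ei ej ek eqxx. Qed.

Ltac indices t :=
  lazymatch t with
  | ?a * ?b =>
      let p := indices a in let q := indices b in eval cbv [cat] in (p ++ q)
  | ?a ^+ 2 => let p := indices a in eval cbv [cat] in (p ++ p)
  | ?a ^+ 3 => let p := indices a in eval cbv [cat] in (p ++ p ++ p)
  | _ ?i => constr:([:: i])
  end.

Section Included.
Variables (R : comPzRingType) (G : seq R).
Implicit Types (A B : seq R).

Definition included A := forall g, g \in A -> g \in G.

Lemma included_cat A B : included (A ++ B) -> included A /\ included B.
Proof. by move=> AB; split=> g gA; apply: AB; rewrite mem_cat gA ?orbT. Qed.

Lemma included_cons g A : included (g :: A) -> g \in G /\ included A.
Proof.
by move=> AB; split=> [|h hA]; apply: AB; rewrite inE ?eqxx // hA ?orbT.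
Qed.

Lemma included_map (F : int -> R) lo hi :
  included [seq F t | t <- irange lo hi] ->
  forall t, lo <= t <= hi -> F t \in G.
Proof. by move=> FG t ht; apply/FG/map_f; rewrite mem_irange. Qed.

Lemma included_map_filter (F : int -> R) (p : pred int) lo hi :
    included [seq F t | t <- irange lo hi & p t] ->
  forall t, lo <= t <= hi -> p t -> F t \in G.
Proof.
by move=> FG t ht pt; apply/FG/map_f; rewrite mem_filter pt mem_irange.
Qed.

Lemma included_if (b : bool) A B : included (if b then A else B) ->
  b /\ included A \/ ~~ b /\ included B.
Proof. by case: b; [left | right]. Qed.

Lemma included_then (b : bool) A B :
  b -> included (if b then A else B) -> included A.
Proof. by move=> ->. Qed.

Lemma included_else (b : bool) A B :
  ~~ b -> included (if b then A else B) -> included B.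
Proof. by move=> /negbTE->. Qed.
End Included.

Section Regimes.
Variables (e m n : int) (R : comPzRingType) (x : int -> R) (G : seq R).
Notation lead := (leads e m n x G).
Notation rewrites u v := (same_weight e m n u v && smaller v u).

(** The list u' is the sorted rearrangement of the indices u read off the
    formula for g. *)
Lemma leadI g u v u' : g \in G -> g = monomial x u - monomial x v ->
  perm_eq u u' -> rewrites u' v -> lead u'.
Proof.
move=> gG eg puu /andP[b1 b2]; exists v; split=> //.
by left; rewrite {1}/monomial -(perm_big _ puu) -/(monomial x u) -eg.
Qed.

Lemma leadIC g u v u' : g \in G -> g = monomial x v - monomial x u ->
  perm_eq u u' -> rewrites u' v -> lead u'.
Proof.
move=> gG eg puu /andP[b1 b2]; exists v; split=> //.
by right; rewrite {2}/monomial -(perm_big _ puu) -/(monomial x u) -eg.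
Qed.

Lemma avoid2 i j a b : ~ lead [:: i; j] -> lead [:: a; b] ->
  i = a -> j = b -> False.
Proof. by move=> nl l ei ej; apply: nl; rewrite ei ej. Qed.

(** The parameter t of the family is to be chosen as a function of i and j, the
    one with which x_i x_j would be the member for t if it were in the family. *)
Lemma avoid2_family i j (lo hi : int) a b t : ~ lead [:: i; j] ->
  (forall t, lo <= t <= hi -> lead [:: a t; b t]) ->
  i = a t -> j = b t -> lo <= t <= hi -> False.
Proof. by move=> nl l ei ej ht; apply: nl; rewrite ei ej; apply: l. Qed.

Lemma avoid2_family_if i j (lo hi : int) (p : pred int) a b t :
  ~ lead [:: i; j] ->
  (forall t, lo <= t <= hi -> p t -> lead [:: a t; b t]) ->
  i = a t -> j = b t -> lo <= t <= hi -> p t -> False.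
Proof. by move=> nl l ei ej ht pt; apply: nl; rewrite ei ej; apply: l. Qed.

Lemma avoid3 i j k a b c : ~ lead [:: i; j; k] -> lead [:: a; b; c] ->
  i = a -> j = b -> k = c -> False.
Proof. by move=> nl l ei ej ek; apply: nl; rewrite ei ej ek. Qed.

(** A product x_i x_j with 1 <= i <= j or x_0^2 x_k that is not a leading monomial
    of a minor of A has an index next to a gap; this leaves the following to be
    checked for the other lists. *)
Definition boundary_complete :=
  [/\ forall i j : int, 1 <= i -> i <= j -> j <= e - 2 ->
        i != m -> i != n -> j != m -> j != n ->
        [\/ i = m + 1, i = n + 1, j = m - 1 | j = n - 1] ->
        ~ lead [:: i; j] -> [:: i; j] \in exceptional e m n,
      forall k : int, k != m -> k != n -> k = m - 1 \/ k = n - 1 ->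
        ~ lead [:: 0; 0; k] -> [:: 0; 0; k] \in exceptional e m n,
      triples0_complete e m n x G & triples_complete e m n x G].

Section Minors.
Let column i : R * R := (x i, x (i + 1)).

Lemma mem_minors_cat c d (A B : seq (R * R)) :
  c \in A -> d \in B -> minor2 c d \in minors (A ++ B).
Proof.
elim: A => //= a A IH; rewrite inE mem_cat => /orP[/eqP->|cA] dB.
  by rewrite map_f // mem_cat dB orbT.
by rewrite IH // orbT.
Qed.

(** The order of the two columns only affects the sign of the minor. *)
Lemma mem_minors_map (f : int -> R * R) s B i j : i \in s -> j \in s -> i != j ->
  minor2 (f i) (f j) \in minors (map f s ++ B) \/
  minor2 (f j) (f i) \in minors (map f s ++ B).
Proof.
elim: s => //= a s IH; rewrite !inE !mem_cat.
have map_mem k : k \in s -> f k \in map f s ++ B.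
  by move=> ks; rewrite mem_cat map_f.
move=> /predU1P[->|si] /predU1P[->|sj] ij; first by rewrite eqxx in ij.
- by left; rewrite map_f // map_mem.
- by right; rewrite map_f // map_mem.
- by case: (IH si sj ij) => ->; rewrite orbT; auto.
Qed.

(** s is the list of the upper indices of the columns of A_n or A_(m,n) but
    the last. *)
Variable s : seq int.
Hypothesis columnsG :
  included G (minors (map column s ++ [:: (x (e - 1), x 0 ^+ 2)])).
Hypothesis columns_s : forall i,
  generator e m n i -> generator e m n (i + 1) -> i \in s.
Hypotheses (he : 10 <= e) (hm : 1 <= m) (hmn : m < n) (hn : n <= e - 2).

Lemma minor_lead i j : i <= j ->
  generator e m n (i - 1) -> generator e m n i ->
  generator e m n j -> generator e m n (j + 1) -> lead [:: i; j].
Proof.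
move=> ij gi' gi gj gj'.
have si : i - 1 \in s by apply: columns_s; rewrite // subrK.
have sj : j \in s by apply: columns_s.
have ok : rewrites [:: i; j] [:: i - 1; j + 1].
  rewrite /same_weight /smaller /= gi gi' gj gj' /weight /=; lia.
have nij : i - 1 != j by lia.
have [mG|mG] :=
  @mem_minors_map column s [:: (x (e - 1), x 0 ^+ 2)] _ _ si sj nij.
- apply: (leadIC (columnsG mG) _ (perm_refl _) ok).
  by rewrite /minor2 /= subrK /monomial !big_cons !big_nil; ring.
- apply: (leadI (columnsG mG) _ (perm_refl _) ok).
  by rewrite /minor2 /= subrK /monomial !big_cons !big_nil; ring.
Qed.

Lemma minor_last i :
  generator e m n i -> generator e m n (i + 1) -> lead [:: 0; 0; i].
Proof.
move=> gi gi'; have si : i \in s by apply: columns_s.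
have ok : rewrites [:: 0; 0; i] [:: i + 1; e - 1].
  move: gi gi'; rewrite /same_weight /smaller /generator /weight /=; lia.
have mG : minor2 (column i) (x (e - 1), x 0 ^+ 2) \in G.
  by apply/columnsG/mem_minors_cat; rewrite ?map_f ?inE.
apply: (leadI mG _ (perm_refl _) ok).
by rewrite /minor2 /= /monomial !big_cons !big_nil; ring.
Qed.

Lemma complete_of_boundary : boundary_complete -> complete e m n x G.
Proof.
move=> [P2 P00 P0 P3]; split=> // [i j i1 ij je gi gj nl|k k0 ke gk nl].
  have [? ?] : i != m /\ i != n by case/and4P: gi.
  have [? ?] : j != m /\ j != n by case/and4P: gj.
  apply: P2 => //; have [->|im] := eqVneq i (m + 1); first by constructor 1.
  have [->|inn] := eqVneq i (n + 1); first by constructor 2.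
  have [->|jm] := eqVneq j (m - 1); first by constructor 3.
  have [->|jn] := eqVneq j (n - 1); first by constructor 4.
  by case: nl; apply: minor_lead => //; move: gi gj; rewrite /generator; lia.
have [? ?] : k != m /\ k != n by case/and4P: gk.
apply: P00 => //; have [->|km] := eqVneq k (m - 1); first by left.
have [->|kn] := eqVneq k (n - 1); first by right.
by case: nl; apply: minor_last => //; move: gk; rewrite /generator; lia.
Qed.
End Minors.

Section Lists.
Hypotheses (he : 10 <= e) (hm : 1 <= m) (hmn : m < n) (hn : n <= e - 2).
Hypothesis hexc : (m != e - 4) || (n != e - 3).

Ltac purge := repeat match goal with
  | H : included _ _ |- _ => clear H
  | H : leads _ _ _ _ _ _ |- _ => clear H
  | H : ~ leads _ _ _ _ _ _ |- _ => clear H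
  | H : forall t, is_true (_ <= t <= _) -> _ |- _ => clear H
  end.

Ltac arith :=
  purge; repeat match goal with
  | H : is_true (_ \in _) |- _ => clear H
  | H : forall _, _ |- _ => clear H
  end; lia.

Ltac resolve_if := rewrite ?inE;
  repeat (let h := fresh "h" in
    first [ case: ifP => [h|_]; first by (exfalso; arith)
          | case: ifP => [_|h]; last by (exfalso; arith)
          | case: ifP => h ]).

Ltac resolve_list S :=
  match type of S with
  | included _ (if ?b then _ else _) =>
    let h := fresh "h" in let S' := fresh "S" in
    first
    [ have h : ~~ b by rewrite ?inE; arith
    | have h : b by rewrite ?inE; arith ];
    first [ have S' := included_else h S | have S' := included_then h S ];
    clear S h; rename S' into S; resolve_list S
  | included _ (if ?b then _ else _) =>
    let h := fresh "h" in let S' := fresh "S" in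
    case: (included_if S) => -[h S']; rewrite ?inE in h;
    clear S; rename S' into S; resolve_list S
  | _ => idtac
  end.

Ltac sorted_indices t :=
  let u := indices t in
  lazymatch u with
  | [:: ?a; ?b] => match constr:(True) with
      | _ => let z := constr:(ltac:(arith) : a <= b) in constr:(u)
      | _ => constr:([:: b; a]) end
  | [:: ?a; ?b; ?c] => match constr:(True) with
      | _ => let z := constr:(ltac:(arith) : a <= b <= c) in constr:(u)
      | _ => constr:([:: c; a; b]) end
  end.

Ltac prove_perm u :=
  first [ exact: (perm_refl u)
        | exact: (permEl (perm_catC [:: _] [:: _]))
        | exact: (permEl (perm_catC [:: _; _] [:: _])) ].

Ltac prove_lead I H p q :=
  let u := indices p in let v := indices q in
  apply: (I _ u v _ H);
  [ rewrite /monomial !big_cons !big_nil; ring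
  | prove_perm u
  | rewrite /same_weight /smaller /generator /weight /=; arith ].

Ltac lead_of H :=
  lazymatch type of H with
  | is_true (?p - ?q \in _) =>
    let L := fresh "L" in
    first
    [ let u := sorted_indices p in have L : lead u by prove_lead leadI H p q
    | let u := sorted_indices q in have L : lead u by prove_lead leadIC H q p ]
  end.

Ltac lead_of_instance F H t :=
  let try_lead p :=
    (let u := sorted_indices p in
     lazymatch eval pattern t in u with
     | ?f _ => let b := eval unfold F in F in unify b f; change (lead u)
     end) in
  lazymatch type of H with
  | is_true (?p - ?q \in _) =>
    first [ try_lead p; prove_lead leadI H p q
          | try_lead q; prove_lead leadIC H q p ]
  end.

Ltac lead_of_family M :=
  let L := fresh "L" in let F := fresh "F" in
  let t := fresh "t" in let ht := fresh "ht" in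
  let pt := fresh "pt" in let H := fresh "H" in
  evar (F : int -> seq int);
  lazymatch type of M with
  | forall t, is_true (?lo <= t <= ?hi) -> is_true (_ \in ?G') =>
    have L : forall t : int, lo <= t <= hi -> lead (F t);
    [ intros t ht; have H := M t ht; cbn beta in H; lead_of_instance F H t
    | ]
  | forall t, is_true (?lo <= t <= ?hi) -> is_true (@?p t) -> is_true _ =>
    have L : forall t : int, lo <= t <= hi -> p t -> lead (F t);
    [ intros t ht pt; have H := M t ht pt; cbn beta in H, pt;
      rewrite ?inE in pt; lead_of_instance F H t
    | ]
  end;
  subst F; cbn beta in L.

(* From S : included G A, the leading monomials of all binomials in the list A,
   with one fact for each family. *)
Ltac harvest S :=
  let S1 := fresh "S" in let S2 := fresh "S" in let M := fresh "M" in
  lazymatch type of S with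
  | included _ nil => clear S
  | included _ (_ ++ _) =>
      case: (included_cat S) => S1 S2; clear S; harvest S1; harvest S2
  | included _ (_ :: _) =>
      case: (included_cons S) => M S2; clear S; harvest S2; lead_of M; clear M
  | included _ (map _ (irange _ _)) =>
      have M := included_map S; cbn beta iota delta [comp fst snd] in M;
      clear S; lead_of_family M; clear M
  | included _ (map _ (filter _ _)) =>
      have M := included_map_filter S; cbn beta in M;
      clear S; lead_of_family M; clear M
  end.

(* In most families the indices of the leading monomial differ by the parameter
   t, which is therefore j - i.  The exceptions are x_2 x_t or x_3 x_t in the
   minors of B, and x_(n-3-t) x_(n-1). *)
Ltac clauses2 nl i j :=
  repeat match goal with
  | L : leads _ _ _ _ _ [:: _; _] |- _ =>
      let A := fresh "A" in have A := avoid2 nl L; clear L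
  | L : leads _ _ _ _ _ _ |- _ => clear L
  | L : forall t, is_true (_ <= t <= _) -> leads _ _ _ _ _ [:: _; t] |- _ =>
      let A := fresh "A" in
      have A := avoid2_family (t := j) nl L; cbn beta in A; clear L
  | L : forall t, is_true (_ <= t <= _) ->
        leads _ _ _ _ _ [:: ?c - 3 - t; ?c - 1] |- _ =>
      let A := fresh "A" in
      have A := avoid2_family (t := j - i - 2) nl L; cbn beta in A; clear L
  | L : forall t, is_true (_ <= t <= _) -> leads _ _ _ _ _ _ |- _ =>
      let A := fresh "A" in
      have A := avoid2_family (t := j - i) nl L; cbn beta in A; clear L
  | L : forall t, is_true (_ <= t <= _) -> _ -> leads _ _ _ _ _ _ |- _ =>
      let A := fresh "A" in
      have A := avoid2_family_if (t := j - i) nl L; cbn beta in A;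
      rewrite ?inE in A; clear L
  end; purge.

Ltac clauses3 nl :=
  repeat match goal with
  | L : leads _ _ _ _ _ [:: _; _; _] |- _ =>
      let A := fresh "A" in have A := avoid3 nl L; clear L
  end; purge.

Ltac exceptional_clauses H :=
  lazymatch type of H with
  | is_true (_ \notin nil) => clear H
  | is_true (_ \notin _ :: _) =>
    let H1 := fresh "E" in let H2 := fresh "nE" in let E := fresh "E" in
    case: (notin_consE H) => H1 H2; clear H; exceptional_clauses H2;
    lazymatch type of H1 with
    | is_true ([:: _; _] != [:: _; _]) => have E := neq2 H1
    | is_true ([:: _; _; _] != [:: _; _; _]) => have E := neq3 H1
    | _ => idtac
    end; clear H1
  end.

Ltac exceptional_cases H :=
  lazymatch type of H with
  | is_true (_ \in nil) => by move: H; rewrite in_nil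
  | is_true (_ \in _ :: _) =>
    let E := fresh "E" in
    case: (in_consE H) => E; clear H;
    [ try discriminate E; injection E; clear E;
      do 2! (let h := fresh in move=> h)
    | exceptional_cases E ]
  end.

(* A context clause P1 -> ... -> Pk -> False is resolved one literal at a time,
   so that linear arithmetic only meets conjunctions; disequalities, each of
   which would double its search, are kept for a second attempt. *)
Ltac facts_lia :=
  repeat match goal with
  | H : _ -> False |- _ => clear H
  | H : _ -> _ -> _ |- _ => clear H
  end;
  first
  [ repeat match goal with
    | H : ~ _ |- _ => clear H
    | H : (~~ _) = true |- _ => clear H
    | H : (_ || _) = true |- _ => clear H
    end; lia
  | lia ].

Ltac refute :=
  let branch H P :=
    let p := fresh in
    first [ assert (p : ~ P) by facts_lia; clear H p
          | assert (p : P) by facts_lia; specialize (H p); clear p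
          | assert (P \/ ~ P) as [p|p] by facts_lia;
            [specialize (H p) | clear H] ] in
  lazymatch goal with
  | H : False |- _ => case: H
  | H : ?P -> False |- False => branch H P; refute
  | H : ?P -> _ -> _ |- False => branch H P; refute
  | |- False => facts_lia
  end.

(* The context holds the leading monomials found in the lists. *)
Ltac solve_boundary :=
  let EX := fresh "EX" in have EX := erefl (exceptional e m n);
  move: EX; rewrite {2}/exceptional /stand_0m /stand_0n /stand_m /stand_n;
  resolve_if => EX;
  let i := fresh "i" in let j := fresh "j" in let k := fresh "k" in
  let nl := fresh "nl" in let nE := fresh "nE" in let X := fresh "X" in
  let M1 := fresh "M1" in let M2 := fresh "M2" in let M3 := fresh "M3" in
  split;
  [ move=> i j ? ? ? ? ? ? ? X nl;
    apply: decide_by_contra => nE; rewrite EX in nE; clear EX;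
    exceptional_clauses nE; clauses2 nl i j; Zify.zify; case: X => ?; refute
  | move=> k ? ? X nl;
    apply: decide_by_contra => nE; rewrite EX in nE; clear EX;
    exceptional_clauses nE; clauses3 nl; Zify.zify; case: X => ?; refute
  | move=> j k ? ? M1 nl;
    apply: decide_by_contra => nE; rewrite !EX in nE M1; clear EX;
    exceptional_clauses nE; clauses3 nl; exceptional_cases M1;
    Zify.zify; refute
  | move=> i j k ? ? ? M1 M2 M3 nl; rewrite !EX in M1 M2 M3; clear EX;
    clauses3 nl; exceptional_cases M1; try (exfalso; facts_lia);
    exceptional_cases M3; try (exfalso; facts_lia);
    exceptional_cases M2; Zify.zify; refute ].

(** One lemma for each way in which the lists are defined: [regime1] for m = 1 and
    [regime2] for m >= 2.  In the names, e2, e3, e4, e5 stand for e - 2, e - 3,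
    e - 4, e - 5, [inner] for an index away from the ends, [adjacent] for
    n = m + 1 and [skip1] for n = m + 2. *)
Definition regime1 (c : bool) := m = 1 -> c ->
  included G (first_col_minors (B1 x e n)) -> included G (L1 x e n) ->
  included G (G' x e m n) -> boundary_complete.

Definition regime2 (c : bool) := c ->
  included G (K2 x e m n) -> included G (G' x e m n) -> boundary_complete.

Ltac solve_regime1 :=
  let c := fresh "c" in let m1 := fresh "m1" in
  let S0 := fresh "S" in let S1 := fresh "S" in let S2 := fresh "S" in
  (* The hypotheses on e, m, n are translated here once and for all. *)
  move=> m1 c S0 S1 S2; Zify.zify;
  rewrite /L1 in S1; resolve_list S1; rewrite /G' in S2; resolve_list S2;
  move: S0; rewrite /B1 /first_col_minors /cols; resolve_if;
  rewrite ?cat1s; do 3 rewrite ?map_cat /=;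
  rewrite -?map_comp /minor2 /= => S0;
  harvest S0; harvest S1; harvest S2; solve_boundary.

Ltac solve_regime2 :=
  let c := fresh "c" in let S1 := fresh "S" in let S2 := fresh "S" in
  move=> c S1 S2; Zify.zify;
  rewrite /K2 in S1; resolve_list S1; rewrite /G' in S2; resolve_list S2;
  harvest S1; harvest S2; solve_boundary.

Lemma boundary_1_2 : regime1 (n == 2).
Proof. solve_regime1. Qed.

Lemma boundary_1_3 : regime1 (n == 3).
Proof. solve_regime1. Qed.

Lemma boundary_1_4 : regime1 (n == 4).
Proof. solve_regime1. Qed.

Lemma boundary_1_inner : regime1 (5 <= n <= e - 4).
Proof. solve_regime1. Qed.

Lemma boundary_1_e3 : regime1 (n == e - 3).
Proof. solve_regime1. Qed.

Lemma boundary_1_e2 : regime1 (n == e - 2).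
Proof. solve_regime1. Qed.

Lemma boundary_2_3 : regime2 ((m == 2) && (n == 3)).
Proof. solve_regime2. Qed.

Lemma boundary_2_4 : regime2 ((m == 2) && (n == 4)).
Proof. solve_regime2. Qed.

Lemma boundary_2_5 : regime2 ((m == 2) && (n == 5)).
Proof. solve_regime2. Qed.

Lemma boundary_2_inner : regime2 ((m == 2) && (6 <= n <= e - 4)).
Proof. solve_regime2. Qed.

Lemma boundary_2_e3 : regime2 ((m == 2) && (n == e - 3)).
Proof. solve_regime2. Qed.

Lemma boundary_2_e2 : regime2 ((m == 2) && (n == e - 2)).
Proof. solve_regime2. Qed.

Lemma boundary_3_4 : regime2 ((m == 3) && (n == 4)).
Proof. solve_regime2. Qed.

Lemma boundary_adjacent : regime2 ((4 <= m <= e - 6) && (n == m + 1)).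
Proof. solve_regime2. Qed.

Lemma boundary_e5_e4 : regime2 ((m == e - 5) && (n == e - 4)).
Proof. solve_regime2. Qed.

Lemma boundary_e3_e2 : regime2 ((m == e - 3) && (n == e - 2)).
Proof. solve_regime2. Qed.

Lemma boundary_skip1 : regime2 ((3 <= m <= e - 6) && (n == m + 2)).
Proof. solve_regime2. Qed.

Lemma boundary_e5_e3 : regime2 ((m == e - 5) && (n == e - 3)).
Proof. solve_regime2. Qed.

Lemma boundary_e4_e2 : regime2 ((m == e - 4) && (n == e - 2)).
Proof. solve_regime2. Qed.

Lemma boundary_inner : regime2 ((3 <= m) && (m + 2 < n <= e - 4)).
Proof. solve_regime2. Qed.

Lemma boundary_inner_e3 : regime2 ([&& 3 <= m, m + 2 < n & n == e - 3]).
Proof. solve_regime2. Qed.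

Lemma boundary_inner_e2 : regime2 ([&& 3 <= m, m + 2 < n & n == e - 2]).
Proof. solve_regime2. Qed.

Lemma boundary_m1 : m = 1 -> included G (first_col_minors (B1 x e n)) ->
  included G (L1 x e n) -> included G (G' x e m n) -> boundary_complete.
Proof.
move=> m1 S0 S1 S2.
have : n = 2 \/ n = 3 \/ n = 4 \/ 5 <= n <= e - 4 \/ n = e - 3 \/ n = e - 2.
  by arith.
case=> [?|[?|[?|[?|[?|?]]]]].
- by apply: boundary_1_2 => //; arith.
- by apply: boundary_1_3 => //; arith.
- by apply: boundary_1_4 => //; arith.
- by apply: boundary_1_inner => //; arith.
- by apply: boundary_1_e3 => //; arith.
- by apply: boundary_1_e2 => //; arith.
Qed.

Lemma boundary_m2 : 2 <= m -> included G (K2 x e m n) ->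
  included G (G' x e m n) -> boundary_complete.
Proof.
move=> m2 S1 S2.
have [m2'|m3] : m = 2 \/ 3 <= m by arith.
  have : n = 3 \/ n = 4 \/ n = 5 \/ 6 <= n <= e - 4 \/ n = e - 3 \/ n = e - 2.
    by arith.
  case=> [?|[?|[?|[?|[?|?]]]]].
  - by apply: boundary_2_3 => //; arith.
  - by apply: boundary_2_4 => //; arith.
  - by apply: boundary_2_5 => //; arith.
  - by apply: boundary_2_inner => //; arith.
  - by apply: boundary_2_e3 => //; arith.
  - by apply: boundary_2_e2 => //; arith.
have [n1|[n2|n3]] : n = m + 1 \/ n = m + 2 \/ m + 2 < n by arith.
- have : m = 3 \/ 4 <= m <= e - 6 \/ m = e - 5 \/ m = e - 3 by arith.
  case=> [?|[?|[?|?]]].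
  + by apply: boundary_3_4 => //; arith.
  + by apply: boundary_adjacent => //; arith.
  + by apply: boundary_e5_e4 => //; arith.
  + by apply: boundary_e3_e2 => //; arith.
- have : 3 <= m <= e - 6 \/ m = e - 5 \/ m = e - 4 by arith.
  case=> [?|[?|?]].
  + by apply: boundary_skip1 => //; arith.
  + by apply: boundary_e5_e3 => //; arith.
  + by apply: boundary_e4_e2 => //; arith.
- have : n <= e - 4 \/ n = e - 3 \/ n = e - 2 by arith.
  case=> [?|[?|?]].
  + by apply: boundary_inner => //; arith.
  + by apply: boundary_inner_e3 => //; arith.
  + by apply: boundary_inner_e2 => //; arith.
Qed.
End Lists.
End Regimes.

(** * The elements of calG lie in the ideal *)

Section Balanced.
Variables (e m n : int) (R : comPzRingType) (x : int -> R).
Notation generator := (generator e m n).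
Notation same_weight := (same_weight e m n).
Implicit Types (A B : seq R) (C : seq (R * R)).

Definition balanced A := forall g, g \in A ->
  exists u v, same_weight u v /\ g = monomial x u - monomial x v.

Lemma balanced_cat A B : balanced A -> balanced B -> balanced (A ++ B).
Proof. by move=> bA bB g; rewrite mem_cat => /orP[/bA|/bB]. Qed.

Lemma balanced_nil : balanced [::].
Proof. by []. Qed.

Lemma balanced_cons g A u v : g = monomial x u - monomial x v ->
  same_weight u v -> balanced A -> balanced (g :: A).
Proof.
by move=> gE uv bA h; rewrite inE => /predU1P[->|/bA//]; exists u, v.
Qed.

Lemma balanced_map (F : int -> R) (u v : int -> seq int) lo hi :
  (forall t, F t = monomial x (u t) - monomial x (v t)) ->
  (forall t, lo <= t <= hi -> same_weight (u t) (v t)) ->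
  balanced [seq F t | t <- irange lo hi].
Proof.
move=> FE uv g /mapP[t]; rewrite mem_irange => ht ->.
by exists (u t), (v t); rewrite FE uv.
Qed.

Lemma balanced_map_filter (F : int -> R) (u v : int -> seq int)
    (p : pred int) lo hi :
  (forall t, F t = monomial x (u t) - monomial x (v t)) ->
  (forall t, lo <= t <= hi -> p t -> same_weight (u t) (v t)) ->
  balanced [seq F t | t <- irange lo hi & p t].
Proof.
move=> FE uv g /mapP[t]; rewrite mem_filter mem_irange => /andP[pt ht] ->.
by exists (u t), (v t); rewrite FE uv.
Qed.

(** In every column of the matrices the lower entry weighs d more than the upper
    one, with d depending on the matrix only; this makes the two terms of
    each minor equally heavy. *)
Definition shifted (d : int) C := forall c, c \in C ->
  exists u v, [/\ all generator u, all generator v,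
    weight e v = weight e u + d & c = (monomial x u, monomial x v)].

Lemma shifted_cat d C D : shifted d C -> shifted d D -> shifted d (C ++ D).
Proof. by move=> sC sD c; rewrite mem_cat => /orP[/sC|/sD]. Qed.

Lemma shifted_cols d a b :
  (forall i, a <= i <= b -> generator i && generator (i + d)) ->
  shifted d (cols x d a b).
Proof.
move=> gab c /mapP[i]; rewrite mem_irange => /gab /andP[gi gd] ->.
exists [:: i], [:: i + d]; rewrite /= gi gd; split=> //; last first.
  by rewrite /monomial !big_seq1.
by rewrite /weight /=; ring.
Qed.

Lemma shifted1 d c u v : c = (monomial x u, monomial x v) ->
  all generator u -> all generator v -> weight e v = weight e u + d ->
  shifted d [:: c].
Proof. by move=> cE gu gv wuv c'; rewrite inE => /eqP->; exists u, v. Qed.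

Lemma weight_cat u v : weight e (u ++ v) = weight e u + weight e v.
Proof. by elim: u => [|i u IH] /=; rewrite ?add0r // IH addrA. Qed.

Lemma shifted_minor d C c c' : shifted d C -> c \in C -> c' \in C ->
  exists u v, same_weight u v /\ minor2 c c' = monomial x u - monomial x v.
Proof.
move=> sC /sC[u [v [gu gv wv ->]]] /sC[u' [v' [gu' gv' wv' ->]]].
exists (u ++ v'), (u' ++ v); split; last by rewrite /monomial !big_cat.
rewrite /same_weight !all_cat gu gv gu' gv' !weight_cat wv wv' /=.
by apply/eqP; ring.
Qed.

Lemma balanced_minors d C : shifted d C -> balanced (minors C).
Proof.
elim: C => //= c C IH sC; apply: balanced_cat; last first.
  by apply: IH => c' cC; apply: sC; rewrite inE cC orbT.
move=> g /mapP[c' cC ->].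
by apply: (shifted_minor sC); rewrite inE ?eqxx ?cC ?orbT.
Qed.

Lemma balanced_first_col_minors d C : shifted d C ->
  balanced (first_col_minors C).
Proof.
case: C => //= c C sC g /mapP[c' cC ->].
by apply: (shifted_minor sC); rewrite inE ?eqxx ?cC ?orbT.
Qed.

Hypotheses (he : 10 <= e) (hm : 1 <= m) (hmn : m < n) (hn : n <= e - 2).

Ltac indices_fun F :=
  constr:(fun t : int => ltac:(
    let b := eval cbv beta in (F t) in let u := indices b in exact u)).
Ltac weigh :=
  rewrite /same_weight /generator /weight /=; lia.
Ltac expand := rewrite /monomial !big_cons !big_nil; ring.
Ltac family lem F :=
  lazymatch F with
  | fun t => @?p t - @?q t =>
    let u := indices_fun p in let v := indices_fun q in
    apply: (lem _ u v)
  end.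
Ltac balance :=
  lazymatch goal with
  | |- balanced nil => exact: balanced_nil
  | |- balanced (_ ++ _) => apply: balanced_cat; balance
  | |- balanced (?p - ?q :: _) =>
    let u := indices p in let v := indices q in
    apply: (@balanced_cons _ _ u v); [expand | weigh | balance]
  | |- balanced (map ?F (irange _ _)) =>
    family balanced_map F; [move=> t; expand | move=> t ?; weigh]
  | |- balanced (map ?F (filter _ _)) =>
    family balanced_map_filter F;
    [move=> t; expand | move=> t ?; rewrite ?inE => ?; weigh]
  end.

Ltac shift u v :=
  apply: (@shifted1 _ _ u v);
  [ by rewrite /monomial !big_cons !big_nil; congr (_, _); ring
  | by rewrite /= /generator; lia
  | by rewrite /= /generator; lia
  | by rewrite /weight /=; lia ].

Lemma balanced_A1 : m = 1 -> balanced (minors (A1 x e n)).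
Proof.
move=> m1; apply: (@balanced_minors 1); do !apply: shifted_cat.
- by apply: shifted_cols => i; rewrite /generator; lia.
- by apply: shifted_cols => i; rewrite /generator; lia.
- shift [:: e - 1] [:: 0 : int; 0].
Qed.

Lemma balanced_A2 : balanced (minors (A2 x e m n)).
Proof.
apply: (@balanced_minors 1); do !apply: shifted_cat.
- by apply: shifted_cols => i; rewrite /generator; lia.
- by apply: shifted_cols => i; rewrite /generator; lia.
- by apply: shifted_cols => i; rewrite /generator; lia.
- shift [:: e - 1] [:: 0 : int; 0].
Qed.

Lemma balanced_B1 : m = 1 -> balanced (first_col_minors (B1 x e n)).
Proof.
move=> m1; rewrite /B1; case: ifP => n2.
  apply: (@balanced_first_col_minors 3); do !apply: shifted_cat.
  - shift [:: 0 : int] [:: 3 : int].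
  - by apply: shifted_cols => i; rewrite /generator; lia.
  - shift [:: e - 3] [:: 0 : int; 0].
apply: (@balanced_first_col_minors 2); do !apply: shifted_cat.
- shift [:: 0 : int] [:: 2 : int].
- by apply: shifted_cols => i; rewrite /generator; lia.
- shift [:: n - 1] [:: n + 1].
- by apply: shifted_cols => i; rewrite /generator; lia.
- by case: ifP => // ?; shift [:: e - 2] [:: 0 : int; 0].
Qed.

Lemma balanced_L1 : m = 1 -> balanced (L1 x e n).
Proof. by move=> m1; rewrite /L1; do 6! (case: ifP => [?|_]; first by balance). Qed.

Lemma balanced_K2 : 2 <= m -> balanced (K2 x e m n).
Proof. by move=> m2; rewrite /K2; do 16! (case: ifP => [?|_]; first by balance). Qed.

Lemma balanced_G' : balanced (G' x e m n).
Proof.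
rewrite /G'; case: ifP => [m1|_].
  by rewrite !inE; do 4! (case: ifP => [?|_]; first by balance).
case: ifP => [m2|_].
  by rewrite !inE; do 5! (case: ifP => [?|_]; first by balance).
case: ifP => [hm3|_].
  by do 4! (case: ifP => [?|_]; first by balance).
by do ?(case: ifP => [?|_]; try by balance).
Qed.

Lemma balanced_calG : balanced (calG x e m n).
Proof.
apply: balanced_cat; last exact: balanced_G'.
rewrite /G; case: ifP => [/eqP m1|m1]; last first.
  by apply: balanced_cat; [exact: balanced_A2 | apply: balanced_K2; lia].
apply: balanced_cat; first exact: balanced_A1.
by apply: balanced_cat; [exact: balanced_B1 | exact: balanced_L1].
Qed.
End Balanced.

(** * Monomials as lists of indices *)

Section Bridge.
Variables (e m n : nat).
Notation N := (size (vars e m n)).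
Notation gen := (generator e%:Z m%:Z n%:Z).
Implicit Types (u v s : seq int) (a b : 'X_{1..N}).

Definition index_of (j : 'I_N) : int := (nth 0%N (vars e m n) j)%:Z.

Lemma index_of_generator j : gen (index_of j).
Proof.
have := mem_nth 0%N (ltn_ord j).
rewrite mem_filter mem_iota /generator /index_of.
by move: (nth _ _ _) => k; lia.
Qed.

Lemma index_of_lt (i j : 'I_N) : (i < j)%N -> index_of i < index_of j.
Proof.
move=> ij; rewrite /index_of ltz_nat.
apply: (sorted_ltn_nth ltn_trans) => //; rewrite ?inE ?ltn_ord //.
by apply: sorted_filter; [exact: ltn_trans | exact: iota_ltn_sorted].
Qed.

Lemma index_of_inj : injective index_of.
Proof.
move=> i j ij; apply: val_inj; case: (ltngtP i j) => // /index_of_lt;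
by rewrite ij ltxx.
Qed.

Lemma index_of_surj i : gen i -> exists j, index_of j = i.
Proof.
case: i => [i|i] // /and4P[_ ie im inn].
have iv : i \in vars e m n by rewrite mem_filter mem_iota; lia.
have iN : (index i (vars e m n) < N)%N by rewrite index_mem.
by exists (Ordinal iN); rewrite /index_of /= nth_index.
Qed.

Definition exponent s : 'X_{1..N} := [multinom count_mem (index_of j) s | j < N].

Lemma exponent_nil : exponent [::] = 0%MM.
Proof. by apply/mnmP => j; rewrite !mnmE. Qed.

Lemma exponent_cat s t : exponent (s ++ t) = (exponent s + exponent t)%MM.
Proof. by apply/mnmP => j; rewrite mnmDE !mnmE count_cat. Qed.

Lemma exponent1 j : exponent [:: index_of j] = U_(j)%MM.
Proof.
apply/mnmP => k; rewrite mnmE mnm1E /= addn0.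
by rewrite (inj_eq index_of_inj).
Qed.

Lemma exponent_perm s t : perm_eq s t -> exponent s = exponent t.
Proof. by move=> /permP st; apply/mnmP => j; rewrite !mnmE st. Qed.

Lemma exponent_subseq u s : subseq u s -> (exponent u <= exponent s)%MM.
Proof. by move=> us; apply/mnm_lepP => j; rewrite !mnmE leq_count_subseq. Qed.

Lemma exponent_surj a :
  exists s, [/\ all gen s, sorted <=%R s & exponent s = a].
Proof.
have [s gs ea] : exists2 s, all gen s & exponent s = a.
  pose s := \big[cat/[::]]_(j < N) nseq (a j) (index_of j).
  exists s.
    rewrite /s; elim/big_ind: _ => // [u v|j _]; first by rewrite all_cat => ->.
    by rewrite all_nseq index_of_generator orbT.
  apply/mnmP => k; rewrite mnmE /s.
  rewrite (big_morph (count_mem (index_of k)) (count_cat _) (erefl _)).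
  rewrite (bigD1 k) //= count_nseq /= eqxx mul1n big1 ?addn0 // => j jk.
  by rewrite count_nseq /= (inj_eq index_of_inj) (negbTE jk).
exists (sort <=%R s); split.
- by rewrite all_sort.
- exact: (sort_sorted le_total).
- by rewrite -ea; apply/exponent_perm/permEl/perm_sort.
Qed.

Lemma mdeg_exponent s : all gen s -> mdeg (exponent s) = size s.
Proof.
elim: s => [|i s IH] /=; first by rewrite exponent_nil mdeg0.
case/andP => /index_of_surj[j <-] /IH <-.
by rewrite -cat1s exponent_cat mdegD exponent1 mdeg1.
Qed.

Lemma max_in v : v != [::] -> exists2 d, d \in v & all (fun i => i <= d) v.
Proof.
elim: v => // i v IH _; have [->|/IH[d dv vd]] := eqVneq v [::].
  by exists i; rewrite ?inE //= lexx.
have [id|di] := leP i d; first by exists d; rewrite ?inE ?dv ?orbT //= id.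
exists i; rewrite ?inE ?eqxx //= lexx /=.
by apply: sub_all vd => k kd; apply: le_trans kd (ltW di).
Qed.

Lemma smaller_grevlex u v : all gen u -> all gen v ->
  smaller v u -> grevlex_lt (exponent v) (exponent u).
Proof.
move=> gu gv; rewrite /grevlex_lt !mdeg_exponent //.
case/orP => [->//|/andP[-> /hasP[d0 d0v d0u]]].
apply/orP; right; rewrite /=.
have [|d dv vd] := @max_in v; first by case: (v) d0v.
have d0d : d0 <= d by apply: (allP vd).
have ud i : i \in u -> i < d by move=> /(allP d0u) /lt_le_trans; apply.
have /(allP gv)/index_of_surj[j dj] := dv.
apply/existsP; exists j; apply/andP; split.
  rewrite !mnmE dj (count_memPn _); first by rewrite -has_count has_pred1.
  by apply/negP => /ud; rewrite ltxx.
apply/forallP => k; apply/implyP => /index_of_lt; rewrite dj => dk.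
rewrite !mnmE !(count_memPn _) //; apply/negP.
  by move=> /ud; rewrite ltNge ltW.
by move=> /(allP vd) /=; rewrite leNgt dk.
Qed.

Definition wdeg a : nat := (\sum_(j < N) a j * (e + nth 0 (vars e m n) j))%N.

Lemma wdegD a b : wdeg (a + b)%MM = (wdeg a + wdeg b)%N.
Proof.
by rewrite -big_split; apply: eq_bigr => j _; rewrite mnmDE mulnDl.
Qed.

Lemma wdeg1 j : (wdeg U_(j))%:Z = e%:Z + index_of j.
Proof.
rewrite /wdeg (bigD1 j) //= mnm1E eqxx mul1n big1 ?addn0 // => k kj.
by rewrite mnm1E eq_sym (negbTE kj).
Qed.

Lemma wdeg_exponent s : all gen s -> (wdeg (exponent s))%:Z = weight e%:Z s.
Proof.
elim: s => [|i s IH] /=.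
  by rewrite exponent_nil /wdeg big1 // => j _; rewrite mnm0E.
case/andP => /index_of_surj[j <-] /IH <-.
by rewrite -cat1s exponent_cat wdegD exponent1 PoszD wdeg1.
Qed.

Variable K : fieldType.
Notation x := (@xvar K e m n).

Lemma xvar_index j : x (index_of j) = 'X_j.
Proof.
rewrite /xvar (big_pred1 j) // => k.
by rewrite /= (inj_eq index_of_inj).
Qed.

Lemma monomialE s : all gen s -> monomial x s = 'X_[exponent s].
Proof.
elim: s => [|i s IH] /=; first by rewrite /monomial big_nil exponent_nil mpolyX0.
case/andP => /index_of_surj[j <-] /IH; rewrite /monomial => E.
by rewrite big_cons E xvar_index -cat1s exponent_cat mpolyXD exponent1.
Qed.

Lemma semigroup_mapE f : semigroup_map f =
  \sum_(a <- msupp f) f@_a *: 'X^(wdeg a) :> {poly K}.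
Proof.
rewrite /semigroup_map /mmap; apply: eq_bigr => a _.
rewrite mul_polyC; congr (_ *: _); rewrite /mmap1 /wdeg -prodrXr.
by apply: eq_bigr => j _; rewrite -exprM mulnC.
Qed.

Lemma semigroup_mapX a : semigroup_map 'X_[a] = 'X^(wdeg a) :> {poly K}.
Proof. by rewrite semigroup_mapE msuppX big_seq1 mcoeffX eqxx scale1r. Qed.

Lemma binomial_in_ideal u v : same_weight e%:Z m%:Z n%:Z u v ->
  semigroup_ideal (monomial x u - monomial x v).
Proof.
move=> /and3P[gu gv /eqP wuv].
rewrite /semigroup_ideal !monomialE // /semigroup_map rmorphB /=.
rewrite -![mmap _ _ _]/(semigroup_map _) !semigroup_mapX.
suff -> : wdeg (exponent u) = wdeg (exponent v) by rewrite subrr.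
by apply/eqP; rewrite -eqz_nat !wdeg_exponent // wuv.
Qed.

(** Otherwise the coefficient of t^w in the image of f, where w is the weight of
    a, would be the leading coefficient of f. *)
Lemma lead_not_alone (f : semigroup_ring K e m n) a :
  semigroup_ideal f -> is_lead (@grevlex_lt N) f a ->
  exists b, wdeg b = wdeg a /\ grevlex_lt b a.
Proof.
move=> If [af lta].
have [/hasP[b bf /andP[ba /eqP wb]]|/hasPn no] :=
  boolP (has (fun b => (b != a) && (wdeg b == wdeg a)) (msupp f)).
  by exists b; split=> //; apply: lta.
have /(congr1 (fun p : {poly K} => p`_(wdeg a))) := If.
rewrite semigroup_mapE coef_sum coef0 (bigD1_seq a) ?msupp_uniq //=.
rewrite coefZ coefXn eqxx mulr1 big1_seq => [|b /andP[ba bf]].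
  by rewrite addr0 => /eqP; rewrite mcoeff_eq0 af.
rewrite coefZ coefXn; have := no b bf; rewrite ba /= eq_sym => /negbTE->.
by rewrite mulr0.
Qed.
End Bridge.

(** * Uniqueness of avoiding monomials and the theorem *)

Lemma complete_calG (e m n : int) (R : comPzRingType) (x : int -> R)
    (Gs : seq R) :
  10 <= e -> 1 <= m -> m < n -> n <= e - 2 -> (m != e - 4) || (n != e - 3) ->
  included Gs (calG x e m n) -> complete e m n x Gs.
Proof.
move=> he hm hmn hn hexc /included_cat[+ G'S].
rewrite /G; case: ifP => [/eqP m1|m1] GS.
  have [AS BLS] := included_cat GS; have [BS LS] := included_cat BLS.
  move: AS; rewrite /A1 /cols catA -map_cat => AS.
  apply: (complete_of_boundary AS) => //; last exact: boundary_m1.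
  by move=> i; rewrite mem_cat !mem_irange /generator; lia.
have [AS KS] := included_cat GS.
move: AS; rewrite /A2 /cols !catA -!map_cat => AS.
apply: (complete_of_boundary AS) => //; last by apply: boundary_m2 => //; lia.
by move=> i; rewrite !mem_cat !mem_irange /generator; lia.
Qed.

Section Uniqueness.
Variables (e m n : int) (R : comPzRingType) (x : int -> R) (G : seq R).
Hypotheses (he : 10 <= e) (hm : 1 <= m) (hmn : m < n) (hn : n <= e - 2).
Hypothesis hexc : (m != e - 4) || (n != e - 3).
Hypothesis Gcomplete : complete e m n x G.

Lemma weight_perm s t : perm_eq s t -> weight e s = weight e t.
Proof.
have wE u : weight e u = \sum_(i <- u) (e + i).
  by elim: u => [|i u IH]; rewrite ?big_nil // big_cons -IH.
by move=> st; rewrite !wE; apply: perm_big.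
Qed.

Lemma weight_nseq k i : weight e (nseq k i) = k%:Z * (e + i).
Proof.
elim: k => [|k IH] /=; first by rewrite mul0r.
by rewrite IH -addn1 PoszD; ring.
Qed.

Definition reduced s := [/\ all (generator e m n) s, sorted <=%R s &
  forall u, subseq u s -> ~ leads e m n x G u].

(** As x_(e-1) is the last variable, its occurrences form the tail of s. *)
Lemma reduced_split s : reduced s -> exists b k,
  [/\ perm_eq s (b ++ nseq k (e - 1)), standard e m n b &
      weight e s = weight e b + k%:Z * (2 * e - 1)].
Proof.
move=> [gs ss ns]; pose p i := i <= e - 2.
exists (filter p s), (size (filter (predC p) s)).
have E : nseq (size (filter (predC p) s)) (e - 1) = filter (predC p) s.
  apply/esym/all_pred1P/allP => i; rewrite mem_filter => /andP[pi si].
  by have := allP gs i si; move: pi; rewrite /p /generator /=; lia.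
have P : perm_eq s (filter p s ++ nseq (size (filter (predC p) s)) (e - 1)).
  by rewrite E perm_sym perm_filterC.
split=> //.
  apply: (classification he hm hmn hn hexc Gcomplete).
  - exact: (sorted_filter le_trans).
  - by rewrite all_filter; apply: sub_all gs => i gi /=; rewrite gi implybT.
  - exact: filter_all.
  - by move=> u ub; apply: ns; apply: subseq_trans ub (filter_subseq _ _).
rewrite (weight_perm P) weight_cat weight_nseq; ring.
Qed.

Lemma reduced_unique s t : reduced s -> reduced t ->
  weight e s = weight e t -> perm_eq s t.
Proof.
move=> /reduced_split[b [k [sb stb ws]]] /reduced_split[c [l [tc stc wt]]].
rewrite ws wt => w.
have bc : b = c.
  apply: (standard_inj (d := l%:Z - k%:Z) stb stc); move: w.
  rewrite mulrBl; lia.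
have kl : k = l by move: w; rewrite bc => /addrI; nia.
by rewrite (perm_trans sb) // bc kl perm_sym.
Qed.
End Uniqueness.

Theorem theorem4p6 (K : closedFieldType) (charK0 : [pchar K] =i pred0)
    (e m n : nat) (he : (10 <= e)%N) (hm : (1 <= m)%N) (hmn : (m < n)%N)
    (hn : (n <= e - 2)%N) (hexc : (m, n) <> (e - 4, e - 3)%N) :
  groebner_basis (@grevlex_lt (size (vars e m n)))
    (@semigroup_ideal K e m n)
    (calG (@xvar K e m n) e%:Z m%:Z n%:Z).
Proof.
have ze : 10 <= e%:Z by lia.
have zm : 1 <= m%:Z by lia.
have zmn : m%:Z < n%:Z by lia.
have zn : n%:Z <= e%:Z - 2 by lia.
have zexc : (m%:Z != e%:Z - 4) || (n%:Z != e%:Z - 3).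
  apply: contraT; rewrite negb_or !negbK => /andP[/eqP a /eqP b].
  by case: hexc; congr (_, _); lia.
set x := @xvar K e m n; set Gs := calG x e m n.
have Gcomplete : complete e m n x Gs.
  exact: (complete_calG ze zm zmn zn zexc (fun g gG => gG)).
apply: groebner_of_leads.
  move=> g /(balanced_calG ze zm zmn zn)[u [v [uv ->]]].
  exact: binomial_in_ideal.
pose reducible a := exists u, leads e m n x Gs u /\ (exponent e m n u <= a)%MM.
have reduced_exponent s : all (generator e m n) s -> sorted <=%R s ->
    ~ reducible (exponent e m n s) -> reduced e m n x Gs s.
  move=> gs ss irr; split=> // u us lu; apply: irr; exists u; split=> //.
  exact: exponent_subseq.
(* Replacing a leading monomial by the other term keeps the weight. *)
have step w a : wdeg a = w -> ~ reducible a \/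
    exists2 b, wdeg b = w & grevlex_lt b a.
  move=> aw; have [[u [[v [uv vu _]] ua]]|irr] := classic (reducible a);
    [right | by left].
  have /and3P[gu gv /eqP wuv] := uv.
  exists ((a - exponent e m n u) + exponent e m n v)%MM; last first.
    rewrite -{2}(submK ua) ![(_ - _ + _)%MM]addmC grevlex_add2r.
    exact: smaller_grevlex.
  rewrite -aw -[in RHS](submK ua) !wdegD; congr (_ + _)%N.
  by apply/eqP; rewrite -eqz_nat !wdeg_exponent // wuv.
move=> f a If la.
have [[u [[v [uv vu sgn]] ua]]|irr] := classic (reducible a).
  have /and3P[gu gv _] := uv; have lt_vu := smaller_grevlex gu gv vu.
  have neq : exponent e m n v != exponent e m n u.
    by apply/eqP => E; rewrite E grevlex_irr in lt_vu.
  have [l1 l2] := is_lead_binomial K lt_vu neq.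
  by case: sgn => gG; do 2 eexists; split; first [exact: gG | exact: ua | idtac];
    rewrite !monomialE.
(* The two avoiding monomials of equal weight: a itself, and c below a. *)
exfalso; have [b [wb ba]] := lead_not_alone If la.
have [c [wc irrc cb]] := grevlex_descent (step (wdeg a)) wb.
have ca : grevlex_lt c a.
  by case: cb => [->//|cb]; apply: grevlex_trans cb ba.
have [s [gs ss sa]] := exponent_surj a; have [t [gt st tc]] := exponent_surj c.
move: ca irr irrc wc; rewrite -sa -tc => ca irr irrc wc.
have st_perm : perm_eq s t.
  apply: (reduced_unique ze zm zmn zn zexc Gcomplete).
  - exact: reduced_exponent.
  - exact: reduced_exponent.
  - by rewrite -(wdeg_exponent gs) -(wdeg_exponent gt) wc.
by rewrite (exponent_perm _ _ _ st_perm) grevlex_irr in ca.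
Qed.
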